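(* Let $\ell\in\mathbb{Z}$ and $m\in\{0,1,2,\ldots\}$ with $m\ge\ell$. For all $x\in\mathbb{R}$, $x\neq0$, $$\int_0^\infty\frac{e^{-t}\ln t}{t^{(1+\ell)/2}}\,I_{2m+1-\ell}\left(2\sqrt{xt}\right)dt=\frac{1}{m!}\Big\{(-1)^{m-\ell}(H_m-\gamma)\,x^{-m+(\ell-1)/2}\left[e^{x}\mathcal{P}(-\ell,m-\ell,-x)-\mathcal{P}(\ell,m,x)\right]-x^{m+(1-\ell)/2}\left[e^{x}\mathcal{F}(-\ell,m-\ell,-x)-\mathcal{F}(\ell,m,x)\right]\Big\}$$ and $$\int_0^\infty\frac{e^{-t}\ln t}{t^{(1-\ell)/2}}\,J_{2m+1-\ell}\left(2\sqrt{xt}\right)dt=\frac{1}{(m-\ell)!}\Big\{(-1)^{m-\ell}(H_{m-\ell}-\gamma)\,x^{-m+(\ell-1)/2}\left[\mathcal{P}(-\ell,m-\ell,-x)-e^{-x}\mathcal{P}(\ell,m,x)\right]+x^{m+(1-\ell)/2}\left[\mathcal{F}(-\ell,m-\ell,-x)-e^{-x}\mathcal{F}(\ell,m,x)\right]\Big\}.$$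
   Context: $J_\nu$ and $I_\nu$ are the Bessel and modified Bessel functions of the first kind; for $x<0$ square roots and powers are taken with the principal branch. $\gamma$ is Euler's constant and $H_n=\sum_{k=1}^n\frac1k$ ($H_0=0$). For integers $s,k$ with $k\ge0$ and $k\ge s$, $$\mathcal{P}(s,k,z)=\sum_{n=0}^{k}\binom{k}{n}(2k-s-n)!\,z^n,\qquad \mathcal{F}(s,k,z)=\sum_{n=0}^{k}(-1)^n\binom{k}{n}\frac{d^{\,n+k-s}}{dz^{\,n+k-s}}\left[\frac{\ln z-\mathrm{Chi}(z)-\mathrm{Shi}(z)+\gamma}{z}\right],$$ where $\mathrm{Shi}(z)=\int_0^z\frac{\sinh t}{t}dt$ and $\mathrm{Chi}(z)=\gamma+\ln z+\int_0^z\frac{\cosh t-1}{t}dt$ (same branch of $\ln z$ in both places, so the bracket is an entire function of $z$). *)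

(* Defs.v *)
From Stdlib Require Import Reals ZArith.
From Coquelicot Require Import Coquelicot.

(* Stdlib reals together with Coquelicot's complex numbers [C]. *)

Local Open Scope C_scope.

Definition Cexp (z : C) : C := (exp (Re z) * cos (Im z), exp (Re z) * sin (Im z))%R.

Definition Csinh (z : C) : C := (Cexp z - Cexp (- z)) / 2.
Definition Ccosh (z : C) : C := (Cexp z + Cexp (- z)) / 2.

(* Principal argument, in (-PI, PI] for z <> 0; it equals PI on the negative
   real axis.  The value at 0 is junk, and so are those of [Clog] and
   [Cpower] there. *)
Definition Carg (z : C) : R :=
  if Rle_dec 0 (Im z) then acos (Re z / Cmod z) else (- acos (Re z / Cmod z))%R.

Definition Clog (z : C) : C := (ln (Cmod z), Carg z).

Definition Cpower (z : C) (a : R) : C := Cexp (RtoC a * Clog z).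

(* Unlike [Cpower z (1/2)], this also gives the right value at 0. *)
Definition Csqrt (z : C) : C :=
  RtoC (sqrt (Cmod z)) * Cexp (0%R, (Carg z / 2)%R).

(* Sum of a complex series, taken componentwise since [Series] is real-valued. *)
Definition CSeries (a : nat -> C) : C :=
  (Series (fun k => Re (a k)), Series (fun k => Im (a k))).

(* Bessel functions of the first kind, of nonnegative integer order. *)
Definition BesselJ (nu : nat) (z : C) : C :=
  CSeries (fun k =>
    RtoC ((-1) ^ k / (INR (fact k) * INR (fact (nu + k)))) * (z / 2) ^ (2 * k + nu)).

Definition BesselI (nu : nat) (z : C) : C :=
  CSeries (fun k =>
    RtoC (/ (INR (fact k) * INR (fact (nu + k)))) * (z / 2) ^ (2 * k + nu)).

(* H_n; the sum is empty, hence 0, for n = 0. *)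
Definition harmonic (n : nat) : R := sum_n_m (fun k : nat => / INR k)%R 1 n.

Definition euler_gamma : R :=
  real (Lim_seq (fun n => harmonic n - ln (INR n))%R).

(* Integral of f from 0 to z along the segment [0, z]. *)
Definition CInt0 (f : C -> C) (z : C) : C :=
  RInt (V := C_R_CompleteNormedModule) (fun s : R => z * f (RtoC s * z)) 0 1.

(* The integrands below have removable singularities at 0, an endpoint of the
   segment, whose value does not affect the integrals. *)
Definition Shi (z : C) : C := CInt0 (fun w => Csinh w / w) z.

Definition Chi (z : C) : C :=
  RtoC euler_gamma + Clog z + CInt0 (fun w => (Ccosh w - 1) / w) z.

(* [C_derive] is the complex derivative wherever the function is complex
   differentiable. *)
Definition C_derive_n (n : nat) (f : C -> C) : C -> C := Nat.iter n C_derive f.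

(* The quotient extends to an entire function of z.  The value the formula has
   at z = 0 is junk; it does not affect the derivatives of any order at a
   point z <> 0. *)
Definition chi_bracket (z : C) : C :=
  (Clog z - Chi z - Shi z + RtoC euler_gamma) / z.

(* [calP s k] and [calF s k] are meant for s <= k, in which case the integers
   under [Z.to_nat] are nonnegative. *)
Definition calP (s : Z) (k : nat) (z : C) : C :=
  sum_n (G := C_AbelianMonoid) (fun n =>
    RtoC (Binomial.C k n
          * INR (fact (Z.to_nat (2 * Z.of_nat k - s - Z.of_nat n)))) * z ^ n) k.

Definition calF (s : Z) (k : nat) (z : C) : C :=
  sum_n (G := C_AbelianMonoid) (fun n =>
    RtoC ((-1) ^ n * Binomial.C k n)
    * C_derive_n (Z.to_nat (Z.of_nat n + Z.of_nat k - s)) chi_bracket z) k.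

(* Main.v *)
(* Write p = m - l and nu = m + p + 1, and let B be the Beta integral.  Expanding the Bessel function
   and integrating termwise with [∫ e^-t t^n ln t = n! (H_n - gamma)] turns the first integral into
   [x^(nu/2) / m!] times [sum_k x^k/k! B(p+k+1, m+1) (H_(p+k) - gamma)], that is,
     [(H_m - gamma) ∫_0^1 s^p (1-s)^m e^(sx) ds + ∫_0^1 s^p (1-s)^m e^(sx) (ln s - ln (1-s)) ds].
   The first integral is elementary and gives the [calP] terms.  The bracket defining [calF] is
   [∫_0^1 ln s e^(sz) ds], so expanding [(1-s)^m] (resp. [s^p], after [s -> 1-s]) in its derivatives
   shows that the second integral gives the [calF] terms.  Both evaluations are done on the power
   series: decreasing m by [s^p (1-s)^(m+1) = s^p (1-s)^m - s^(p+1) (1-s)^m] leaves m = 0.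
   The J integral is the I integral with (m, p, x) replaced by (p, m, -x), up to the square root. *)

Require Import Defs.
From Stdlib Require Import Reals ZArith.
From Coquelicot Require Import Coquelicot.
From Stdlib Require Import Lra Lia.

Local Open Scope R_scope.

(* [ring] and [field] fail when the type of an equation is a structure's carrier instead of [R] or [C]. *)
Ltac eq_over T := match goal with |- ?a = ?b => change (@eq T a b) end.

(** * Exponential generating functions *)

(** The Beta-type integrals are never formed: an integral against e^(sx) is encoded by its sequence
    of moments, so that differentiating in x shifts the sequence and identities between integrals
    become identities between coefficients. The factor H_a - H_b in the logarithmic case originates
    in differentiating B(a+1, b+1) in a and in b and subtracting, where psi(a+b+2) cancels. As
    [euler_gamma] is the limit of H_n - ln n, the integral of e^-t ln t has to be tied to that
    sequence. The bridge is Ein(t), the integral of (1 - e^-s)/s over [0,t], compared with the same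
    integral for (1 - s/n)^n, whose value at t = n is exactly H_n. Termwise integration meets one
    obstacle: for p = 0 the first term is a multiple of e^-t ln t, unbounded at 0, and is exempted
    from the domination. For x < 0 complex values enter only through a constant: sqrt(xt) = sqrt t
    sqrt x on the principal branch, so the integrand is a real function of t times (sqrt x)^nu, and
    x^(-nu/2) is (sqrt x)^nu / x^nu. *)

Definition geom_bounded (c : nat -> R) : Prop :=
  exists M, forall k, Rabs (c k) <= M * 2 ^ k.

Definition egf (c : nat -> R) (x : R) : R :=
  PSeries (fun k => c k / INR (fact k)) x.

Lemma geom_bounded_const (a : R) : geom_bounded (fun _ => a).
Proof.
  exists (Rabs a); intros k.
  assert (1 <= 2 ^ k) by (apply pow_R1_Rle; lra).
  pose proof (Rabs_pos a); nra.
Qed.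

Lemma geom_bounded_mult (b c : nat -> R) :
  (forall k, 0 <= b k <= 1) -> geom_bounded c -> geom_bounded (fun k => b k * c k).
Proof.
  intros Hb [M HM]; exists M; intros k.
  rewrite Rabs_mult, (Rabs_pos_eq (b k)) by apply Hb.
  specialize (HM k); specialize (Hb k); pose proof (Rabs_pos (c k)); nra.
Qed.

Lemma geom_bounded_minus (b c : nat -> R) :
  geom_bounded b -> geom_bounded c -> geom_bounded (fun k => b k - c k).
Proof.
  intros [M HM] [N HN]; exists (M + N); intros k.
  specialize (HM k); specialize (HN k).
  pose proof (Rabs_triang (b k) (- c k)); rewrite Rabs_Ropp in *.
  unfold Rminus; lra.
Qed.

Lemma geom_bounded_scal (a : R) (c : nat -> R) :
  geom_bounded c -> geom_bounded (fun k => a * c k).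
Proof.
  intros [M HM]; exists (Rabs a * M); intros k.
  rewrite Rabs_mult, Rmult_assoc; apply Rmult_le_compat_l; auto using Rabs_pos.
Qed.

Lemma geom_bounded_le1 (c : nat -> R) :
  (forall k, 0 <= c k <= 1) -> geom_bounded c.
Proof.
  intros H; exists 1; intros k.
  assert (1 <= 2 ^ k) by (apply pow_R1_Rle; lra).
  specialize (H k); rewrite Rabs_pos_eq; lra.
Qed.

Lemma geom_bounded_shift (p : nat) (c : nat -> R) :
  geom_bounded c -> geom_bounded (fun k => c (p + k)%nat).
Proof.
  intros [M HM]; exists (M * 2 ^ p); intros k.
  rewrite Rmult_assoc, <- pow_add; apply HM.
Qed.

Lemma pow_div_fact_le_exp (k : nat) (x : R) : 0 <= x -> x ^ k / INR (fact k) <= exp x.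
Proof.
  intros Hx.
  assert (P : forall n, 0 <= / INR (fact n) * x ^ n).
  { intros n; apply Rmult_le_pos; [left; apply Rinv_0_lt_compat, INR_fact_lt_0 | now apply pow_le]. }
  apply Rle_trans with (sum_f_R0 (fun n => / INR (fact n) * x ^ n) k).
  - destruct k; simpl sum_f_R0.
    + right; unfold Rdiv; apply Rmult_comm.
    + pose proof (cond_pos_sum _ k P); unfold Rdiv; rewrite (Rmult_comm (x ^ S k)); simpl in *; lra.
  - apply sum_incr; [apply is_series_Reals, is_pseries_R, is_exp_Reals | apply P].
Qed.

(** For every r >= 0 the terms c_k r^k / k! stay below M (2r)^k / k! <= M e^(2r), so no finite
    radius is possible. *)
Lemma CV_radius_egf (c : nat -> R) :
  geom_bounded c -> CV_radius (fun k => c k / INR (fact k)) = p_infty.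
Proof.
  intros [M HM].
  destruct (CV_radius_bounded (fun k => c k / INR (fact k))) as [Hub _].
  assert (K : forall r, 0 <= r -> Rbar_le r (CV_radius (fun k => c k / INR (fact k)))).
  { intros r Hr; apply Hub; exists (M * exp (2 * r)); intros n.
    assert (0 < INR (fact n)) by apply INR_fact_lt_0.
    replace (c n / INR (fact n) * r ^ n) with (c n * (r ^ n / INR (fact n))) by (field; lra).
    assert (0 <= r ^ n / INR (fact n)).
    { apply Rmult_le_pos; [now apply pow_le | left; now apply Rinv_0_lt_compat]. }
    rewrite Rabs_mult, (Rabs_pos_eq (r ^ n / _)) by easy.
    apply (Rle_trans _ (M * 2 ^ n * (r ^ n / INR (fact n)))).
    - apply Rmult_le_compat_r; auto.
    - replace (M * 2 ^ n * (r ^ n / INR (fact n))) with (M * ((2 * r) ^ n / INR (fact n)))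
        by (rewrite Rpow_mult_distr; field; lra).
      apply Rmult_le_compat_l.
      + pose proof (HM 0%nat); pose proof (Rabs_pos (c 0%nat)); simpl in *; lra.
      + apply pow_div_fact_le_exp; lra. }
  destruct (CV_radius _) as [r| |]; [| easy |].
  - exfalso; specialize (K (Rmax 0 (r + 1)) (Rmax_l _ _)); simpl in K.
    pose proof (Rmax_r 0 (r + 1)); lra.
  - exfalso; apply (K 0); lra.
Qed.

Lemma CV_inside_egf (c : nat -> R) (x : R) :
  geom_bounded c -> Rbar_lt (Rabs x) (CV_radius (fun k => c k / INR (fact k))).
Proof. intros H; now rewrite CV_radius_egf. Qed.

Lemma is_derive_egf (c : nat -> R) (x : R) :
  geom_bounded c -> is_derive (egf c) x (egf (fun k => c (S k)) x).
Proof.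
  intros H.
  replace (egf (fun k => c (S k)) x) with (PSeries (PS_derive (fun k => c k / INR (fact k))) x).
  - now apply is_derive_PSeries, CV_inside_egf.
  - apply PSeries_ext; intros n; unfold PS_derive.
    rewrite fact_simpl, mult_INR; field; split.
    + apply INR_fact_neq_0.
    + now apply not_0_INR.
Qed.

Lemma ex_series_egf (c : nat -> R) (x : R) :
  geom_bounded c -> ex_series (fun k => c k / INR (fact k) * x ^ k).
Proof.
  intros H; apply ex_series_Rabs.
  now apply (CV_disk_inside (fun k => c k / INR (fact k))), CV_inside_egf.
Qed.

Lemma is_series_egf (c : nat -> R) (x : R) :
  geom_bounded c -> is_series (fun k => c k / INR (fact k) * x ^ k) (egf c x).
Proof. intros H; now apply Series_correct, ex_series_egf. Qed.

Lemma egf_ext (b c : nat -> R) (x : R) :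
  (forall k, b k = c k) -> egf b x = egf c x.
Proof. intros E; apply PSeries_ext; intros n; now rewrite E. Qed.

Lemma egf_minus (b c : nat -> R) (x : R) :
  geom_bounded b -> geom_bounded c ->
  egf (fun k => b k - c k) x = egf b x - egf c x.
Proof.
  intros Hb Hc; unfold egf, PSeries.
  rewrite <- Series_minus by now apply ex_series_egf.
  apply Series_ext; intros n; unfold Rdiv; ring.
Qed.

Lemma egf_scal (a : R) (c : nat -> R) (x : R) :
  egf (fun k => a * c k) x = a * egf c x.
Proof.
  unfold egf, PSeries; rewrite <- Series_scal_l.
  apply Series_ext; intros n; unfold Rdiv; ring.
Qed.

Lemma egf_one (x : R) : egf (fun _ => 1) x = exp x.
Proof. rewrite exp_Reals; apply PSeries_ext; intros n; unfold Rdiv; ring. Qed.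

Lemma egf_at_0 (c : nat -> R) : egf c 0 = c 0%nat.
Proof. unfold egf; rewrite PSeries_0; simpl; field. Qed.

(** This is how relations for x f(x), typical of integration by parts, are read off the
    coefficients. *)
Lemma egf_decr (c : nat -> R) (x : R) :
  geom_bounded c ->
  egf c x = c 0%nat + x * egf (fun k => c (S k) / INR (S k)) x.
Proof.
  intros H; unfold egf.
  rewrite PSeries_decr_1 by now apply CV_radius_inside, CV_inside_egf.
  f_equal; [simpl; field|]. f_equal. apply PSeries_ext; intros n; unfold PS_decr_1.
  rewrite fact_simpl, mult_INR; field; split; [now apply not_0_INR | apply INR_fact_neq_0].
Qed.

Lemma inv_le_1 (n : nat) : 0 <= / INR (S n) <= 1.
Proof.
  assert (1 <= INR (S n)) by (rewrite S_INR; pose proof (pos_INR n); lra).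
  split; [left; apply Rinv_0_lt_compat; lra|].
  rewrite <- Rinv_1; apply Rinv_le_contravar; lra.
Qed.

Lemma harmonic_0 : harmonic 0 = 0.
Proof. reflexivity. Qed.

Lemma harmonic_S (n : nat) : harmonic (S n) = harmonic n + / INR (S n).
Proof. unfold harmonic; rewrite sum_n_Sm by lia; reflexivity. Qed.

Lemma harmonic_bound (n : nat) : 0 <= harmonic n <= INR n.
Proof.
  induction n; [rewrite harmonic_0; simpl; lra|].
  rewrite harmonic_S, S_INR; pose proof (inv_le_1 n); rewrite S_INR in *; lra.
Qed.

Lemma INR_le_pow2 (n : nat) : INR n <= 2 ^ n.
Proof.
  induction n; [simpl; lra|].
  assert (1 <= 2 ^ n) by (apply pow_R1_Rle; lra).
  rewrite S_INR; simpl; lra.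
Qed.

Lemma geom_bounded_harmonic : geom_bounded harmonic.
Proof.
  exists 1; intros k; pose proof (harmonic_bound k); pose proof (INR_le_pow2 k).
  rewrite Rabs_pos_eq; lra.
Qed.

(** * Beta integrals against the exponential *)

(* [∫_0^1 s^a (1-s)^b ds] *)
Definition beta (a b : nat) : R :=
  INR (fact a) * INR (fact b) / INR (fact (S (a + b))).

Lemma beta_0 (a : nat) : beta a 0 = / INR (S a).
Proof.
  unfold beta; rewrite Nat.add_0_r, fact_simpl, mult_INR; simpl (INR (fact 0)).
  field; split; [apply not_0_INR; lia | apply INR_fact_neq_0].
Qed.

Lemma beta_S (a b : nat) : beta a (S b) = beta a b - beta (S a) b.
Proof.
  unfold beta.
  replace (a + S b)%nat with (S (a + b)) by lia.
  replace (S a + b)%nat with (S (a + b)) by lia.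
  rewrite !(fact_simpl (S (a + b))), (fact_simpl a), (fact_simpl b), !mult_INR.
  rewrite !S_INR, plus_INR.
  pose proof (pos_INR a); pose proof (pos_INR b).
  field; split; [apply INR_fact_neq_0 | lra].
Qed.

Lemma beta_nonneg (a b : nat) : 0 <= beta a b.
Proof.
  unfold beta; left; apply Rdiv_lt_0_compat; [apply Rmult_lt_0_compat|]; apply INR_fact_lt_0.
Qed.

Lemma beta_bound (a b : nat) : 0 <= beta a b <= 1.
Proof.
  split; [apply beta_nonneg|]; revert a; induction b; intros a.
  - rewrite beta_0; apply inv_le_1.
  - rewrite beta_S; specialize (IHb a); pose proof (beta_nonneg (S a) b); lra.
Qed.

(** * Binomial sums and the elementary Beta integral *)

Definition binom_sum (p : nat) (f : nat -> R) : R :=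
  sum_n (fun n => Binomial.C p n * f n) p.

Lemma binom_sum_0 (f : nat -> R) : binom_sum 0 f = f 0%nat.
Proof. unfold binom_sum; rewrite sum_O; unfold Binomial.C; simpl; field. Qed.

Lemma binom_n_0 (n : nat) : Binomial.C n 0 = 1.
Proof.
  unfold Binomial.C; rewrite Nat.sub_0_r; simpl; field; apply INR_fact_neq_0.
Qed.

Lemma binom_n_n (n : nat) : Binomial.C n n = 1.
Proof. rewrite <- (binom_n_0 n), (pascal_step1 n 0) by lia. now rewrite Nat.sub_0_r. Qed.

Lemma binom_sum_S (p : nat) (f : nat -> R) :
  binom_sum (S p) f = binom_sum p f + binom_sum p (fun n => f (S n)).
Proof.
  unfold binom_sum; rewrite !sum_n_Reals.
  (* Pascal's rule on partial sums leaves the boundary term C(p,q) f(q+1), which at q = p is the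
     last term of the sum for p+1. *)
  assert (E : forall q, (q <= p)%nat ->
    sum_f_R0 (fun n => Binomial.C (S p) n * f n) q + Binomial.C p q * f (S q)
    = sum_f_R0 (fun n => Binomial.C p n * f n) q
      + sum_f_R0 (fun n => Binomial.C p n * f (S n)) q).
  { induction q; intros Hq; simpl sum_f_R0.
    - rewrite !binom_n_0; ring.
    - assert (Hq' : (q <= p)%nat) by lia; specialize (IHq Hq').
      rewrite <- (pascal p q) by lia; lra. }
  rewrite tech5, <- E by lia. rewrite !binom_n_n; reflexivity.
Qed.

Lemma binom_sum_ext (p : nat) (f g : nat -> R) :
  (forall n, (n <= p)%nat -> f n = g n) -> binom_sum p f = binom_sum p g.
Proof.
  intros E; apply sum_n_ext_loc; intros n Hn; now rewrite E.
Qed.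

Lemma binom_sum_scal (p : nat) (a : R) (f : nat -> R) :
  binom_sum p (fun n => a * f n) = a * binom_sum p f.
Proof.
  unfold binom_sum; rewrite <- (sum_n_mult_l (K := R_Ring)).
  apply sum_n_ext; intros n; change mult with Rmult; simpl; ring.
Qed.

(** This is [calP s k] with k = p and s = p - m, since then 2k - s = p + m. In these parameters the
    two polynomials of the closed form differ by swapping the indices and the sign of the
    argument. *)
Definition polyP (p m : nat) (y : R) : R :=
  binom_sum p (fun n => INR (fact (p + m - n)) * y ^ n).

(** Pascal's rule. Used at (p, m, -x) and at (m, p, x), it mirrors [betaT_S] after multiplication by
    a power of x. *)
Lemma polyP_step (p m : nat) (y : R) :
  polyP (S p) m y = polyP p (S m) y + y * polyP p m y.
Proof.
  unfold polyP; rewrite binom_sum_S, <- binom_sum_scal; f_equal; apply binom_sum_ext; intros n Hn.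
  - now replace (S p + m - n)%nat with (p + S m - n)%nat by lia.
  - replace (S p + m - S n)%nat with (p + m - n)%nat by lia; simpl; ring.
Qed.

(** Here C(p,n) (p-n)! = p!/n!, so [polyP p 0] is p! times a truncated exponential series, and
    passing to p+1 appends the top term. *)
Lemma polyP_S_0 (p : nat) (y : R) :
  polyP (S p) 0 y = y ^ S p + INR (S p) * polyP p 0 y.
Proof.
  unfold polyP, binom_sum.
  rewrite sum_Sn, binom_n_n, <- (sum_n_mult_l (K := R_Ring)).
  replace (S p + 0 - S p)%nat with 0%nat by lia.
  change plus with Rplus; rewrite Rplus_comm; f_equal; [simpl; ring|].
  apply sum_n_ext_loc; intros n Hn; 
  change mult with Rmult.
  unfold Binomial.C.
  replace (S p + 0 - n)%nat with (S (p - n)) by lia.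
  replace (S p - n)%nat with (S (p - n)) by lia.
  replace (p + 0 - n)%nat with (p - n)%nat by lia.
  rewrite (fact_simpl (p - n)), (fact_simpl p), !mult_INR.
  eq_over R.
  field; repeat split; try apply INR_fact_neq_0; now apply not_0_INR.
Qed.

(* [∫_0^1 s^p (1-s)^m e^(sx) ds] *)
Definition betaT (p m : nat) (x : R) : R := egf (fun k => beta (p + k) m) x.

Lemma betaT_S (p m : nat) (x : R) : betaT p (S m) x = betaT p m x - betaT (S p) m x.
Proof.
  unfold betaT; rewrite <- egf_minus by (apply geom_bounded_le1; intros; apply beta_bound).
  apply egf_ext; intros k; apply beta_S.
Qed.

Lemma betaT_0_0 (x : R) : x * betaT 0 0 x = exp x - 1.
Proof.
  rewrite <- egf_one, egf_decr by apply geom_bounded_const.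
  ring_simplify; unfold betaT; f_equal; apply egf_ext; intros k.
  rewrite beta_0; unfold Rdiv; simpl (0 + k)%nat; ring.
Qed.

(** Integration by parts for s^(p+1) e^(sx), on coefficients: 1 - (p+1)/(p+k+2) = (k+1)/(p+k+2), and
    [egf_decr] removes the factor k+1. *)
Lemma betaT_S_0 (p : nat) (x : R) : x * betaT (S p) 0 x = exp x - INR (S p) * betaT p 0 x.
Proof.
  rewrite <- egf_one; unfold betaT; rewrite <- (egf_scal (INR (S p))), <- egf_minus.
  - rewrite (egf_decr (fun k => 1 - INR (S p) * beta (p + k) 0)).
    + rewrite beta_0, Nat.add_0_r, Rinv_r, Rminus_diag, Rplus_0_l by now apply not_0_INR.
      f_equal; apply egf_ext; intros k; rewrite !beta_0.
      replace (S (S p + k)) with (S (p + S k)) by lia.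
      rewrite !(S_INR (p + S k)), plus_INR, (S_INR p), (S_INR k).
      pose proof (pos_INR p); pose proof (pos_INR k); field; lra.
    + apply geom_bounded_minus; [apply geom_bounded_const|].
      apply geom_bounded_scal, geom_bounded_le1; intros; apply beta_bound.
  - apply geom_bounded_const.
  - apply geom_bounded_scal, geom_bounded_le1; intros; apply beta_bound.
Qed.

Lemma betaT_closed_form (p m : nat) (x : R) :
  x ^ (S (p + m)) * betaT p m x
  = (-1) ^ p * (exp x * polyP p m (- x) - polyP m p x).
Proof.
  revert p; induction m; intros p.
  - rewrite Nat.add_0_r.
    assert (E : forall q, polyP 0 q x = INR (fact q)).
    { intros q; unfold polyP; rewrite binom_sum_0; simpl; now rewrite Nat.sub_0_r, Rmult_1_r. }
    (* Inner induction along the integration by parts of [betaT_S_0]; the signs are matched by x^k =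
       (-1)^k (-x)^k. *)
    rewrite E. induction p.
    + replace (polyP 0 0 (- x)) with 1 by (unfold polyP; rewrite binom_sum_0; simpl; ring).
      simpl (x ^ 1); rewrite Rmult_1_r, betaT_0_0; simpl; ring.
    + rewrite polyP_S_0, fact_simpl, mult_INR.
      change (x ^ S (S p)) with (x * x ^ S p).
      replace (x * x ^ S p * betaT (S p) 0 x) with (x ^ S p * (x * betaT (S p) 0 x)) by ring.
      rewrite betaT_S_0.
      replace (x ^ S p * (exp x - INR (S p) * betaT p 0 x))
        with (x ^ S p * exp x - INR (S p) * (x ^ S p * betaT p 0 x)) by ring.
      rewrite IHp.
      replace (x ^ S p) with ((-1) ^ S p * (- x) ^ S p); [simpl; ring|].
      rewrite <- Rpow_mult_distr; f_equal; ring.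
  - rewrite betaT_S.
    replace (S (p + S m)) with (S (S (p + m))) by lia.
    change (x ^ S (S (p + m))) with (x * x ^ S (p + m)).
    replace (x * x ^ S (p + m) * (betaT p m x - betaT (S p) m x))
      with (x * (x ^ S (p + m) * betaT p m x) - x ^ S (S p + m) * betaT (S p) m x)
      by (simpl; ring).
    rewrite !IHm, polyP_step, (polyP_step m p x); simpl; ring.
Qed.

(* [∫_0^1 s^p (1-s)^m (ln s - ln (1-s)) e^(sx) ds] *)
Definition betaU (p m : nat) (x : R) : R :=
  egf (fun k => beta (p + k) m * (harmonic (p + k) - harmonic m)) x.

Lemma geom_bounded_betaU (p m : nat) (a : R) :
  geom_bounded (fun k => beta (p + k) m * (harmonic (p + k) - a)).
Proof.
  apply geom_bounded_mult; [intros; apply beta_bound|].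
  apply geom_bounded_minus; [|apply geom_bounded_const].
  apply geom_bounded_shift, geom_bounded_harmonic.
Qed.

Lemma beta_comm_step (a b : nat) : beta (S a) b * INR (S b) = beta a (S b) * INR (S a).
Proof.
  unfold beta; replace (a + S b)%nat with (S a + b)%nat by lia.
  rewrite (fact_simpl a), (fact_simpl b), !mult_INR; field; apply INR_fact_neq_0.
Qed.

(** Besides [beta_S], the shifts of the two harmonic numbers contribute beta(a+1,b)/(a+1) and
    beta(a,b+1)/(b+1). These are equal, so they cancel. *)
Lemma betaU_S (p m : nat) (x : R) : betaU p (S m) x = betaU p m x - betaU (S p) m x.
Proof.
  unfold betaU; rewrite <- egf_minus by apply geom_bounded_betaU.
  apply egf_ext; intros k; rewrite !harmonic_S.
  change (S p + k)%nat with (S (p + k)); rewrite harmonic_S.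
  assert (Ha : INR (S (p + k)) <> 0) by now apply not_0_INR.
  assert (Hm : INR (S m) <> 0) by now apply not_0_INR.
  assert (E : beta (S (p + k)) m * / INR (S (p + k)) = beta (p + k) (S m) * / INR (S m)).
  { apply (Rmult_eq_reg_r (INR (S (p + k)) * INR (S m))); [| now apply Rmult_integral_contrapositive].
    pose proof (beta_comm_step (p + k) m); field_simplify; lra. }
  replace (beta (S (p + k)) m * (harmonic (p + k) + / INR (S (p + k)) - harmonic m))
    with (beta (S (p + k)) m * (harmonic (p + k) - harmonic m) + beta (S (p + k)) m * / INR (S (p + k)))
    by ring.
  rewrite E.
  replace (beta (S (p + k)) m) with (beta (p + k) m - beta (p + k) (S m)) by (rewrite beta_S; ring).
  ring.
Qed.

(* [∫_0^1 s^n ln s e^(sx) ds], the [n]-th derivative of [chi_bracket] on the real line. *)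
Definition gder (n : nat) (x : R) : R :=
  - egf (fun j => / INR (S (n + j)) * / INR (S (n + j))) x.

Lemma geom_bounded_inv_sq (n : nat) :
  geom_bounded (fun j => / INR (S (n + j)) * / INR (S (n + j))).
Proof.
  apply geom_bounded_le1; intros k; pose proof (inv_le_1 (n + k)); nra.
Qed.

Lemma is_derive_gder (n : nat) (x : R) : is_derive (gder n) x (gder (S n) x).
Proof.
  apply (is_derive_opp (V := R_NormedModule)).
  rewrite (egf_ext _ (fun j => (fun j => / INR (S (n + j)) * / INR (S (n + j))) (S j))).
  - apply is_derive_egf, geom_bounded_inv_sq.
  - intros k; simpl Nat.add; now rewrite Nat.add_succ_r.
Qed.

(** The integral of s^p (1-s)^m ln s e^(sx) over [0,1] with (1-s)^m expanded; it is [calF s k] with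
    k = m and s = m - p. *)
Definition altG (m p : nat) (x : R) : R :=
  binom_sum m (fun n => (-1) ^ n * gder (n + p) x).

Lemma altG_0 (p : nat) (x : R) : altG 0 p x = gder p x.
Proof. unfold altG; rewrite binom_sum_0; simpl; ring. Qed.

Lemma altG_S (m p : nat) (x : R) : altG (S m) p x = altG m p x - altG m (S p) x.
Proof.
  unfold altG; rewrite binom_sum_S; unfold Rminus; f_equal.
  replace (- binom_sum m (fun n => (-1) ^ n * gder (n + S p) x))
    with (-1 * binom_sum m (fun n => (-1) ^ n * gder (n + S p) x)) by ring.
  rewrite <- binom_sum_scal; apply binom_sum_ext; intros n _.
  rewrite <- Nat.add_succ_comm; simpl; ring.
Qed.

Lemma is_derive_altG (m p : nat) (x : R) : is_derive (altG m p) x (altG m (S p) x).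
Proof.
  revert p; induction m; intros p.
  - rewrite altG_0; apply (is_derive_ext (gder p)); [intros; now rewrite altG_0|].
    apply is_derive_gder.
  - rewrite altG_S; apply (is_derive_ext (fun x => altG m p x - altG m (S p) x)).
    { intros; now rewrite altG_S. }
    apply (is_derive_minus (V := R_NormedModule)); apply IHm.
Qed.

(** Both sides are the integral of (e^s - 1)/s from 0 to x, with coefficients 1/k. Writing 1/k as
    H_k - H_(k-1) makes it comparable with [egf harmonic]; [pred 0 = 0] gives the vanishing constant
    term. *)
Lemma mul_gder_0 (x : R) :
  - (x * gder 0 x) = egf (fun k => harmonic k - harmonic (pred k)) x.
Proof.
  rewrite egf_decr.
  - simpl pred; rewrite Rminus_diag, Rplus_0_l; unfold gder.
    rewrite <- Ropp_mult_distr_r, Ropp_involutive; f_equal; apply egf_ext; intros k.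
    rewrite harmonic_S; simpl (0 + k)%nat; unfold Rdiv; ring.
  - apply geom_bounded_le1; intros [|k]; simpl pred.
    + rewrite harmonic_0; lra.
    + rewrite harmonic_S; pose proof (inv_le_1 k); lra.
Qed.

Lemma exp_mult_betaT (x : R) : exp (- x) * betaT 0 0 x = betaT 0 0 (- x).
Proof.
  destruct (Req_dec x 0) as [->|Hx].
  - rewrite Ropp_0, exp_0; ring.
  - apply (Rmult_eq_reg_l x); [|easy].
    pose proof (betaT_0_0 x) as E1; pose proof (betaT_0_0 (- x)) as E2.
    replace (x * (exp (- x) * betaT 0 0 x)) with (exp (- x) * (x * betaT 0 0 x)) by ring.
    rewrite E1, Rmult_minus_distr_l, <- exp_plus, Rplus_opp_l, exp_0; lra.
Qed.

Lemma is_derive_mul_gder_0 (x : R) :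
  is_derive (fun x => - (x * gder 0 x)) x (betaT 0 0 x).
Proof.
  apply (is_derive_ext (egf (fun k => harmonic k - harmonic (pred k)))).
  { intros t; now rewrite mul_gder_0. }
  unfold betaT.
  rewrite (egf_ext _ (fun k => (fun k => harmonic k - harmonic (pred k)) (S k))).
  - apply is_derive_egf, geom_bounded_le1; intros [|k]; simpl pred.
    + rewrite harmonic_0; lra.
    + rewrite harmonic_S; pose proof (inv_le_1 k); lra.
  - intros k; simpl pred; rewrite harmonic_S, beta_0; simpl Nat.add. ring.
Qed.

(** After multiplication by e^-x both sides vanish at 0 and have the same derivative: H_(k+1) - H_k
    = 1/(k+1) gives e^-x [betaT 0 0 x], which is [betaT 0 0 (-x)] by the reflection s -> 1-s. *)
Lemma egf_harmonic (x : R) : egf harmonic x = exp x * (- (x * gder 0 (- x))).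
Proof.
  assert (D : forall t, is_derive (fun t => exp (- t) * egf harmonic t - - (- - t * gder 0 (- t))) t 0).
  { intros t.
    evar_last.
    - apply (is_derive_minus (V := R_NormedModule)).
      + apply (is_derive_mult (fun t => exp (- t))); [| | intros; apply Rmult_comm].
        * apply (is_derive_comp exp Ropp); [apply is_derive_exp|].
          apply (is_derive_opp (V := R_NormedModule)), (is_derive_id (K := R_AbsRing)).
        * apply is_derive_egf, geom_bounded_harmonic.
      + apply (is_derive_ext (fun t => - (- (- t * gder 0 (- t))))); [intros u; simpl; ring|].
        apply (is_derive_opp (V := R_NormedModule)).
        apply (is_derive_comp (fun t => - (t * gder 0 t)) Ropp); [apply is_derive_mul_gder_0|].
        apply (is_derive_opp (V := R_NormedModule)), (is_derive_id (K := R_AbsRing)).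
    - rewrite <- exp_mult_betaT.
      replace (betaT 0 0 t) with (egf (fun k => harmonic (S k)) t - egf harmonic t).
      + unfold minus, plus, opp, scal, mult, one; simpl; unfold mult; simpl; ring.
      + rewrite <- egf_minus by (try apply (geom_bounded_shift 1); apply geom_bounded_harmonic).
        unfold betaT; apply egf_ext; intros k; rewrite harmonic_S, beta_0; simpl Nat.add; ring. }
  assert (E : exp (- x) * egf harmonic x - - (- - x * gder 0 (- x)) = 0).
  { replace 0 with (exp (- 0) * egf harmonic 0 - - (- - 0 * gder 0 (- 0)))
      by (rewrite egf_at_0, harmonic_0; ring).
    destruct (Rtotal_order x 0) as [Hx|[->|Hx]]; [|reflexivity|].
    - apply (eq_is_derive (fun t => exp (- t) * egf harmonic t - - (- - t * gder 0 (- t)))); auto.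
    - symmetry.
      apply (eq_is_derive (fun t => exp (- t) * egf harmonic t - - (- - t * gder 0 (- t)))); auto. }
  replace (egf harmonic x) with (exp x * (exp (- x) * egf harmonic x)).
  - replace (exp (- x) * egf harmonic x) with (- (x * gder 0 (- x))) by lra; ring.
  - rewrite <- Rmult_assoc, <- exp_plus, Rplus_opp_r, exp_0; ring.
Qed.

(** After multiplication by x the right side has coefficients H_k - (H_k - H_(k-1)) = H_(k-1), an
    index shift of the left side. The division by x forces a separate check at 0. *)
Lemma betaU_0_0 (x : R) : betaU 0 0 x = gder 0 x - exp x * gder 0 (- x).
Proof.
  destruct (Req_dec x 0) as [->|Hx].
  - unfold betaU; rewrite egf_at_0, Ropp_0, exp_0; simpl Nat.add; ring.
  - apply (Rmult_eq_reg_l x); [|easy].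
    replace (x * (gder 0 x - exp x * gder 0 (- x)))
      with (egf harmonic x - - (x * gder 0 x)) by (rewrite egf_harmonic; ring).
    rewrite mul_gder_0, <- egf_minus.
    + rewrite (egf_ext _ (fun k => harmonic (pred k))) by (intros; ring).
      rewrite egf_decr.
      * simpl pred; rewrite harmonic_0, Rplus_0_l; f_equal; unfold betaU; apply egf_ext; intros k.
        rewrite beta_0, harmonic_0; simpl (0 + k)%nat; unfold Rdiv; ring.
      * exists 1; intros [|k]; simpl pred.
        -- rewrite harmonic_0, Rabs_R0; simpl; lra.
        -- pose proof (harmonic_bound k); pose proof (INR_le_pow2 k).
           rewrite Rabs_pos_eq by lra; simpl; lra.
    + apply geom_bounded_harmonic.
    + apply geom_bounded_le1; intros [|k]; simpl pred.
      * rewrite harmonic_0; lra.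
      * rewrite harmonic_S; pose proof (inv_le_1 k); lra.
Qed.

Lemma is_derive_betaU (p m : nat) (x : R) : is_derive (betaU p m) x (betaU (S p) m x).
Proof.
  unfold betaU at 2.
  rewrite (egf_ext _ (fun k => (fun k => beta (p + k) m * (harmonic (p + k) - harmonic m)) (S k))).
  - apply is_derive_egf, geom_bounded_betaU.
  - intros k; simpl; now rewrite Nat.add_succ_r.
Qed.

(** Differentiating in x raises p by one. On e^x [altG p 0 (-x)] the product rule yields
    [altG p 0 - altG p 1] at -x, which is [altG_S]. *)
Lemma betaU_0 (p : nat) (x : R) : betaU p 0 x = gder p x - exp x * altG p 0 (- x).
Proof.
  revert x; induction p; intros x.
  - rewrite altG_0; apply betaU_0_0.
  - rewrite <- (is_derive_unique _ _ _ (is_derive_betaU p 0 x)).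
    rewrite (Derive_ext _ _ _ IHp); apply is_derive_unique.
    evar_last.
    + apply (is_derive_minus (V := R_NormedModule)); [apply is_derive_gder|].
      apply (is_derive_mult exp); [apply is_derive_exp | | intros; apply Rmult_comm].
      apply (is_derive_comp (altG p 0) Ropp); [apply is_derive_altG|].
      apply (is_derive_opp (V := R_NormedModule)), (is_derive_id (K := R_AbsRing)).
    + rewrite altG_S; unfold minus, plus, opp, scal, mult, one; simpl; unfold mult; simpl; ring.
Qed.

Lemma betaU_closed_form (p m : nat) (x : R) :
  betaU p m x = altG m p x - exp x * altG p m (- x).
Proof.
  revert p; induction m; intros p.
  - rewrite altG_0; apply betaU_0.
  - rewrite betaU_S, !IHm, !altG_S; ring.
Qed.

(** Split H_(p+k) - a as (H_m - a) + (H_(p+k) - H_m): the first part is constant in k and gives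
    [betaT], the second gives [betaU]. *)
Lemma log_series_closed_form (p m : nat) (a x : R) : x <> 0 ->
  egf (fun k => beta (p + k) m * (harmonic (p + k) - a)) x
  = (-1) ^ p * (harmonic m - a) * / x ^ S (p + m) * (exp x * polyP p m (- x) - polyP m p x)
    - (exp x * altG p m (- x) - altG m p x).
Proof.
  intros Hx.
  replace (_ * _ * / _ * _) with ((harmonic m - a) * betaT p m x).
  - replace (_ - (_ - _)) with ((harmonic m - a) * betaT p m x + betaU p m x)
      by (rewrite betaU_closed_form; ring).
    replace (_ + _) with (betaU p m x - (a - harmonic m) * betaT p m x) by ring.
    unfold betaU, betaT; rewrite <- egf_scal, <- egf_minus.
    + apply egf_ext; intros k; ring.
    + apply geom_bounded_betaU.
    + apply geom_bounded_scal, geom_bounded_le1; intros; apply beta_bound.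
  - assert (x ^ S (p + m) <> 0) by now apply pow_nonzero.
    replace (betaT p m x) with (/ x ^ S (p + m) * (x ^ S (p + m) * betaT p m x))
      by (field; auto).
    rewrite betaT_closed_form; ring.
Qed.

(** * Euler's constant and the Gamma integral with a logarithm *)

(* [∫_0^t (1 - e^-s)/s ds] *)
Definition ein (t : R) : R := t * - gder 0 (- t).

Lemma is_derive_ein (t : R) : is_derive ein t (betaT 0 0 (- t)).
Proof.
  apply (is_derive_ext (fun t => - - (- t * gder 0 (- t)))); [intros u; unfold ein; simpl; ring|].
  evar_last.
  - apply (is_derive_opp (V := R_NormedModule)).
    apply (is_derive_comp (fun t => - (t * gder 0 t)) Ropp); [apply is_derive_mul_gder_0|].
    apply (is_derive_opp (V := R_NormedModule)), (is_derive_id (K := R_AbsRing)).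
  - unfold opp, scal, one; simpl; unfold mult; simpl; ring.
Qed.

Lemma betaT_0_0_neg (t : R) : t <> 0 -> betaT 0 0 (- t) = (1 - exp (- t)) / t.
Proof.
  intros Ht; pose proof (betaT_0_0 (- t)).
  apply (Rmult_eq_reg_l t); [|easy]; field_simplify; lra.
Qed.

Lemma ein_0 : ein 0 = 0.
Proof. unfold ein; ring. Qed.

Lemma exp_pow (x : R) (n : nat) : exp x ^ n = exp (INR n * x).
Proof.
  induction n; [simpl; now rewrite Rmult_0_l, exp_0|].
  rewrite S_INR, Rmult_plus_distr_r, exp_plus, <- IHn; simpl; rewrite Rmult_1_l; ring.
Qed.

Lemma bernoulli_sub (a : R) (n : nat) : 0 <= a <= 1 -> 1 - INR n * a <= (1 - a) ^ n.
Proof.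
  intros Ha; induction n; [simpl; lra|].
  rewrite S_INR; simpl pow; pose proof (pos_INR n); nra.
Qed.

(** With u = t/n, the lower bound is 1 - u <= e^-u. For the upper one, e^-u (1+u) <= 1 gives e^-t
    (1-u^2)^n <= (1-u)^n, and Bernoulli's inequality bounds (1-u^2)^n below by 1 - n u^2. *)
Lemma exp_sub_pow_bound (n : nat) (t : R) : (0 < n)%nat -> 0 <= t <= INR n ->
  0 <= exp (- t) - (1 - t / INR n) ^ n <= exp (- t) * (t * t / INR n).
Proof.
  intros Hn Ht.
  assert (Hn' : 0 < INR n) by now apply lt_0_INR.
  set (u := t / INR n).
  assert (Hu : 0 <= u <= 1).
  { unfold u; split; [apply Rdiv_le_0_compat; lra|]. apply Rle_div_l; lra. }
  assert (Et : - t = INR n * - u) by (unfold u; field; lra).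
  assert (E : exp (- t) = exp (- u) ^ n) by (rewrite exp_pow; now f_equal).
  assert (0 < exp (- t)) by apply exp_pos.
  split.
  - rewrite E; enough ((1 - u) ^ n <= exp (- u) ^ n) by lra.
    apply pow_incr; pose proof (exp_ineq1_le (- u)); lra.
  - enough (exp (- t) * (1 - INR n * (u * u)) <= (1 - u) ^ n).
    { replace (t * t / INR n) with (INR n * (u * u)) by (unfold u; field; lra); lra. }
    apply Rle_trans with (exp (- t) * (1 - u * u) ^ n).
    + apply Rmult_le_compat_l; [lra|]; apply bernoulli_sub; nra.
    + rewrite E, <- Rpow_mult_distr; apply pow_incr.
      assert (exp (- u) * (1 + u) <= 1).
      { apply Rle_trans with (exp (- u) * exp u).
        - apply Rmult_le_compat_l; [left; apply exp_pos | apply exp_ineq1_le].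
        - rewrite <- exp_plus, Rplus_opp_l, exp_0; lra. }
      pose proof (exp_pos (- u)); split; [apply Rmult_le_pos; nra|].
      replace (exp (- u) * (1 - u * u)) with (exp (- u) * (1 + u) * (1 - u)) by ring; nra.
Qed.

(* With [j = n] this is [∫_0^t (1 - (1 - s/n)^n)/s ds]: it tends to [ein t], and is [H_n] at [t = n]. *)
Fixpoint trunc_ein (n j : nat) (t : R) : R :=
  match j with
  | O => 0
  | S i => trunc_ein n i t + (1 - (1 - t / INR n) ^ S i) / INR (S i)
  end.

Lemma trunc_ein_0 (n j : nat) : trunc_ein n j 0 = 0.
Proof.
  induction j; [reflexivity|]; cbn [trunc_ein]; rewrite IHj.
  unfold Rdiv; rewrite Rmult_0_l, Rminus_0_r, pow1; ring.
Qed.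

Lemma trunc_ein_diag (n j : nat) : (0 < n)%nat -> trunc_ein n j (INR n) = harmonic j.
Proof.
  intros Hn; assert (0 < INR n) by now apply lt_0_INR.
  induction j; [reflexivity|]; cbn [trunc_ein]; rewrite IHj, harmonic_S.
  unfold Rdiv at 2; rewrite Rinv_r, Rminus_diag, pow_ne_zero by (lra || lia).
  unfold Rdiv; ring.
Qed.

(** The derivative is the geometric sum of (1-t/n)^i / n over i < j. The product form of the second
    clause also covers t = 0. *)
Lemma is_derive_trunc_ein (n j : nat) (t : R) : (0 < n)%nat ->
  exists d, is_derive (trunc_ein n j) t d /\ t * d = 1 - (1 - t / INR n) ^ j.
Proof.
  intros Hn; assert (0 < INR n) by now apply lt_0_INR.
  induction j as [|j [d [Hd Ed]]].
  - exists 0; split; [apply (is_derive_const (V := R_NormedModule)) | simpl; ring].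
  - exists (d + / INR n * (1 - t / INR n) ^ j); split.
    + cbn [trunc_ein]; apply (is_derive_plus (V := R_NormedModule)); [exact Hd|].
      auto_derive; [easy|].
      change (match j with 0%nat => 1 | S _ => INR j + 1 end) with (INR (S j)).
      simpl pred.
      assert (INR (S j) <> 0) by now apply not_0_INR.
      fold (1 - t / INR n); unfold Rdiv; fold (1 - t * / INR n); set (y := (_ - _) ^ j).
      eq_over R; field; split; auto; lra.
    + rewrite Rmult_plus_distr_l, Ed; simpl; field; lra.
Qed.

Lemma is_derive_nonneg_le (f df : R -> R) (a b : R) : a <= b ->
  (forall t, a <= t <= b -> is_derive f t (df t)) ->
  (forall t, a < t < b -> 0 <= df t) -> f a <= f b.
Proof.
  intros Hab Hd Hp; destruct (Req_dec a b) as [->|Hne]; [lra|].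
  destruct (MVT_cor2 f df a b) as [c [E Hc]]; [lra| |].
  - intros c Hc; apply is_derive_Reals; auto.
  - specialize (Hp c Hc); nra.
Qed.

(** The difference is the integral over [0,n] of (e^-s - (1-s/n)^n)/s, which lies between 0 and the
    integral of s e^-s / n. The comparison is made on derivatives. *)
Lemma harmonic_sub_ein (n : nat) : (0 < n)%nat ->
  0 <= harmonic n - ein (INR n) <= / INR n.
Proof.
  intros Hn; assert (Hn' : 0 < INR n) by now apply lt_0_INR.
  assert (D : forall t, exists d, is_derive (fun t => trunc_ein n n t - ein t) t d
     /\ (0 < t <= INR n -> 0 <= d <= exp (- t) * t / INR n)).
  { intros t; destruct (is_derive_trunc_ein n n t Hn) as [d [Hd Ed]].
    exists (d - betaT 0 0 (- t)); split.
    - apply (is_derive_minus (V := R_NormedModule)); [exact Hd | apply is_derive_ein].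
    - intros Ht; rewrite betaT_0_0_neg by lra.
      destruct (exp_sub_pow_bound n t Hn) as [B1 B2]; [lra|].
      replace (d - (1 - exp (- t)) / t) with ((exp (- t) - (1 - t / INR n) ^ n) / t).
      + split; [apply Rdiv_le_0_compat; lra|].
        apply Rle_div_l; [lra|].
        replace (exp (- t) * t / INR n * t) with (exp (- t) * (t * t / INR n)) by (field; lra).
        exact B2.
      + apply (Rmult_eq_reg_l t); [|lra]; field_simplify; lra. }
  assert (D' : forall t, is_derive (fun t => trunc_ein n n t - ein t) t
     (Derive (fun t => trunc_ein n n t - ein t) t)).
  { intros t; destruct (D t) as [d [Hd _]]; apply Derive_correct; now exists d. }
  assert (B : forall t, 0 < t <= INR n ->
    0 <= Derive (fun t => trunc_ein n n t - ein t) t <= exp (- t) * t / INR n).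
  { intros t Ht; destruct (D t) as [d [Hd Bd]].
    replace (Derive (fun t => trunc_ein n n t - ein t) t) with d; [auto|].
    symmetry; now apply is_derive_unique. }
  rewrite <- (trunc_ein_diag n n Hn).
  assert (E0 : trunc_ein n n 0 - ein 0 = 0) by (rewrite trunc_ein_0, ein_0; ring).
  split.
  - rewrite <- E0.
    apply (is_derive_nonneg_le (fun t => trunc_ein n n t - ein t) (Derive (fun t => trunc_ein n n t - ein t)) 0 (INR n));
      [lra | auto | intros t Ht; apply B; lra].
  (* This antiderivative of t e^-t / n starts at -1/n and stays negative, so it grows by at most
     1/n. *)
  - assert (F : forall t, is_derive (fun t => - ((1 + t) * exp (- t)) / INR n) t (exp (- t) * t / INR n)).
    { intros t; auto_derive; [easy|]; field; lra. }
    pose proof (is_derive_nonneg_le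
      (fun t => - ((1 + t) * exp (- t)) / INR n - (trunc_ein n n t - ein t))
      (fun t => exp (- t) * t / INR n - Derive (fun t => trunc_ein n n t - ein t) t) 0 (INR n)) as M.
    cbv beta in M; rewrite E0 in M.
    assert (M' := M (Rlt_le _ _ Hn')); clear M.
    rewrite Ropp_0, exp_0 in M'.
    assert (0 <= (1 + INR n) * exp (- INR n) / INR n).
    { apply Rdiv_le_0_compat; [|lra]; apply Rmult_le_pos; [lra | left; apply exp_pos]. }
    replace (- ((1 + 0) * 1) / INR n) with (- / INR n) in M' by (field; lra).
    replace (- ((1 + INR n) * exp (- INR n)) / INR n)
      with (- ((1 + INR n) * exp (- INR n) / INR n)) in M' by (field; lra).
    enough (- / INR n - 0 <= - ((1 + INR n) * exp (- INR n) / INR n) - (trunc_ein n n (INR n) - ein (INR n))) by lra.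
    apply M'.
    + intros t _; apply (is_derive_minus (V := R_NormedModule)); [apply F | apply D'].
    + intros t Ht; specialize (B t); lra.
Qed.

Lemma ln_le_sub1 (y : R) : 0 < y -> ln y <= y - 1.
Proof. intros Hy; pose proof (exp_ineq1_le (ln y)); rewrite exp_ln in *; lra. Qed.

(** [euler_gamma] is the [real] part of a [Lim_seq], so a finite limit has to be exhibited: the
    sequence decreases and stays above 0, both by ln y <= y - 1. *)
Lemma is_lim_seq_harmonic_sub_ln :
  is_lim_seq (fun n => harmonic n - ln (INR n)) euler_gamma.
Proof.
  apply Lim_seq_correct'.
  (* The shift skips n = 0, where [ln 0] is a default value. *)
  enough (ex_finite_lim_seq (fun n => harmonic (S n) - ln (INR (S n)))) as [l Hl].
  { exists l; now apply (is_lim_seq_incr_1 (fun n => harmonic n - ln (INR n))). }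
  apply ex_finite_lim_seq_decr with (M := 0).
  - intros n.
    rewrite (harmonic_S (S n)).
    assert (0 < INR (S n)) by (apply lt_0_INR; lia).
    assert (0 < INR (S (S n))) by (apply lt_0_INR; lia).
    pose proof (ln_le_sub1 (INR (S n) / INR (S (S n)))) as L.
    rewrite ln_div in L by easy.
    replace (INR (S n) / INR (S (S n)) - 1) with (- / INR (S (S n))) in L
      by (rewrite (S_INR (S n)) in *; field; lra).
    assert (0 < INR (S n) / INR (S (S n))) by now apply Rdiv_lt_0_compat.
    lra.
  - intros n.
    enough (ln (INR (S n)) <= harmonic n) by (rewrite harmonic_S; pose proof (inv_le_1 n); lra).
    induction n; [rewrite harmonic_0; simpl; rewrite ln_1; lra|].
    rewrite harmonic_S.
    assert (0 < INR (S n)) by (apply lt_0_INR; lia).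
    assert (0 < INR (S (S n))) by (apply lt_0_INR; lia).
    pose proof (ln_le_sub1 (INR (S (S n)) / INR (S n))) as L.
    rewrite ln_div in L by easy.
    replace (INR (S (S n)) / INR (S n) - 1) with (/ INR (S n)) in L
      by (rewrite (S_INR (S n)) in *; field; lra).
    assert (0 < INR (S (S n)) / INR (S n)) by now apply Rdiv_lt_0_compat.
    lra.
Qed.

Lemma ein_sub_ln_decr (a b : R) : 0 < a -> a <= b -> ein b - ln b <= ein a - ln a.
Proof.
  intros Ha Hab.
  enough (- (ein a - ln a) <= - (ein b - ln b)) by lra.
  apply (is_derive_nonneg_le (fun t => - (ein t - ln t)) (fun t => - (betaT 0 0 (- t) - / t))); [easy| |].
  - intros t Ht; apply (is_derive_opp (V := R_NormedModule)), (is_derive_minus (V := R_NormedModule)).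
    + apply is_derive_ein.
    + apply is_derive_Reals, derivable_pt_lim_ln; lra.
  - intros t Ht; rewrite betaT_0_0_neg by lra.
    replace (- ((1 - exp (- t)) / t - / t)) with (exp (- t) / t) by (field; lra).
    apply Rdiv_le_0_compat; [left; apply exp_pos | lra].
Qed.

(** The limit along the integers extends to the reals by monotonicity: the value at t lies between
    those at n and n+1, n being the integer part of t. *)
Lemma filterlim_ein_sub_ln :
  filterlim (fun t => ein t - ln t) (Rbar_locally p_infty) (locally euler_gamma).
Proof.
  assert (L : is_lim_seq (fun n => ein (INR n) - ln (INR n)) euler_gamma).
  { replace (Finite euler_gamma) with (Finite (euler_gamma - 0)) by (f_equal; ring).
    apply (is_lim_seq_ext
      (fun n => (harmonic n - ln (INR n)) - (harmonic n - ein (INR n)))); [intros; simpl; ring|].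
    apply is_lim_seq_minus'; [apply is_lim_seq_harmonic_sub_ln|].
    apply is_lim_seq_incr_1.
    apply is_lim_seq_le_le with (u := fun _ => 0) (w := fun n => / INR (S n)).
    - intros n; apply harmonic_sub_ein; lia.
    - apply is_lim_seq_const.
    - apply (is_lim_seq_incr_1 (fun n => / INR n)).
      apply (is_lim_seq_inv _ p_infty); [apply is_lim_seq_INR | easy]. }
  apply is_lim_seq_spec in L.
  apply filterlim_locally; intros eps; destruct (L eps) as [N HN].
  exists (INR N + 1); intros t Ht.
  pose proof (pos_INR N).
  destruct (nfloor_ex t) as [n Hn]; [lra|].
  assert (N < S n)%nat by (apply INR_lt; rewrite S_INR; lra).
  assert (HN1 := HN n); assert (HN2 := HN (S n)); simpl in HN1, HN2.
  assert (0 < INR n) by lra.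
  pose proof (ein_sub_ln_decr (INR n) t ltac:(lra) ltac:(lra)).
  pose proof (ein_sub_ln_decr t (INR (S n)) ltac:(lra) ltac:(rewrite S_INR; lra)).
  apply Rabs_def1.
  - specialize (HN1 ltac:(lia)); apply Rabs_def2 in HN1; unfold minus, plus, opp; simpl; lra.
  - specialize (HN2 ltac:(lia)); apply Rabs_def2 in HN2; unfold minus, plus, opp; simpl; simpl in *; lra.
Qed.

(** * Limits at 0 and at infinity, and explicit antiderivatives *)

Section FilterLimits.

Context {T : Type} {F : (T -> Prop) -> Prop} {FF : Filter F}.
Implicit Types f g : T -> R.

Lemma filterlim_Rplus f g (a b : R) :
  filterlim f F (locally a) -> filterlim g F (locally b) ->
  filterlim (fun t => f t + g t) F (locally (a + b)).
Proof.
  intros Hf Hg; eapply filterlim_comp_2; [exact Hf | exact Hg |].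
  apply (filterlim_plus (V := R_NormedModule)).
Qed.

Lemma filterlim_Rscal f (c a : R) :
  filterlim f F (locally a) -> filterlim (fun t => c * f t) F (locally (c * a)).
Proof.
  intros Hf; apply (filterlim_comp _ _ _ f (Rmult c) _ _ _ Hf).
  apply (filterlim_scal_r (V := R_NormedModule)).
Qed.

Lemma filterlim_Rabs_le_0 f g :
  F (fun t => Rabs (f t) <= g t) -> filterlim g F (locally 0) ->
  filterlim f F (locally 0).
Proof.
  intros Hle Hg.
  apply (filterlim_le_le (fun t => -1 * g t) f g 0); [| |exact Hg].
  - apply filter_imp with (2 := Hle); intros t Ht; apply Rabs_le_between in Ht; lra.
  - simpl; replace 0 with (-1 * 0) by ring; now apply filterlim_Rscal.
Qed.

End FilterLimits.

Lemma at_right_0_pos : at_right 0 (fun t => 0 < t).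
Proof. exists (mkposreal 1 Rlt_0_1); intros; assumption. Qed.

Lemma at_right_0_lt1 : at_right 0 (fun t => 0 < t < 1).
Proof.
  exists (mkposreal 1 Rlt_0_1); intros y Hy Hp; split; [exact Hp|].
  apply Rabs_def2 in Hy; unfold minus, plus, opp in Hy; simpl in Hy; lra.
Qed.

Lemma is_derive_filterlim_at_right (f : R -> R) (x l : R) :
  is_derive f x l -> filterlim f (at_right x) (locally (f x)).
Proof.
  intros H; apply (filterlim_filter_le_1 (F := locally x)); [apply filter_le_within|].
  apply (ex_derive_continuous (V := R_NormedModule)); now exists l.
Qed.

Lemma filterlim_mul_ln_0 : filterlim (fun t => t * ln t) (at_right 0) (locally 0).
Proof.
  apply (filterlim_ext_loc (fun t => ln t * exp (ln t))).
  - apply filter_imp with (2 := at_right_0_pos); intros t Ht; rewrite exp_ln by easy; ring.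
  - apply (is_lim_comp' ln (fun y => y * exp y) m_infty 0).
    + apply is_lim_ln_0.
    + apply is_lim_mul_exp_m.
    + apply filter_forall; discriminate.
Qed.

Lemma exp_le (x y : R) : x <= y -> exp x <= exp y.
Proof.
  intros [H| ->]; [left; now apply exp_increasing | apply Rle_refl].
Qed.

Lemma pow_mul_exp_le (n : nat) (t : R) : 0 < t -> exp (- t) * t ^ n <= INR (fact (S n)) / t.
Proof.
  intros Ht; rewrite exp_Ropp.
  pose proof (pow_div_fact_le_exp (S n) t ltac:(lra)) as H.
  pose proof (exp_pos t); pose proof (INR_fact_lt_0 (S n)).
  apply Rle_div_l in H; [|easy].
  apply (Rle_div_r _ _ _ Ht).
  replace (/ exp t * t ^ n * t) with (t ^ S n / exp t) by (simpl; unfold Rdiv; ring).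
  apply Rle_div_l; [easy|]; lra.
Qed.

Lemma filterlim_pow_mul_exp (n : nat) :
  filterlim (fun t => exp (- t) * t ^ n) (Rbar_locally p_infty) (locally 0).
Proof.
  apply filterlim_Rabs_le_0 with (fun t => INR (fact (S n)) * / t).
  - exists 0; intros t Ht.
    rewrite Rabs_pos_eq; [now apply pow_mul_exp_le|].
    apply Rmult_le_pos; [left; apply exp_pos | apply pow_le; lra].
  - replace 0 with (INR (fact (S n)) * 0) by ring; apply filterlim_Rscal.
    apply (is_lim_inv (fun t => t) p_infty p_infty); [apply is_lim_id | easy].
Qed.

Lemma filterlim_pow_mul_exp_ln (n : nat) :
  filterlim (fun t => exp (- t) * t ^ n * ln t) (Rbar_locally p_infty) (locally 0).
Proof.
  apply filterlim_Rabs_le_0 with (fun t => exp (- t) * t ^ S n); [|apply filterlim_pow_mul_exp].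
  exists 1; intros t Ht.
  assert (0 <= exp (- t) * t ^ n).
  { apply Rmult_le_pos; [left; apply exp_pos | apply pow_le; lra]. }
  assert (0 <= ln t) by (rewrite <- ln_1; apply ln_le; lra).
  pose proof (ln_le_sub1 t ltac:(lra)).
  rewrite Rabs_pos_eq by now apply Rmult_le_pos.
  replace (exp (- t) * t ^ S n) with (exp (- t) * t ^ n * t) by (simpl; ring).
  apply Rmult_le_compat_l; lra.
Qed.

(** Improper integrals are kept as antiderivatives with their limits at both ends, so that
    integration by parts becomes a sum of limits. *)
Lemma exp_pow_antiderivative (n : nat) : exists E : R -> R,
  (forall t, is_derive E t (exp (- t) * t ^ n)) /\
  E 0 = 0 /\ filterlim E (Rbar_locally p_infty) (locally (INR (fact n))).
Proof.
  induction n as [|n [E [HE [E0 EL]]]].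
  - exists (fun t => 1 + -1 * (exp (- t) * t ^ 0)); split; [|split].
    + intros t; auto_derive; [easy|]; simpl; ring.
    + rewrite Ropp_0, exp_0; simpl; ring.
    + replace (INR (fact 0)) with (1 + -1 * 0) by (simpl; ring).
      apply filterlim_Rplus; [apply filterlim_const|].
      apply filterlim_Rscal, filterlim_pow_mul_exp.
  - exists (fun t => -1 * (exp (- t) * t ^ S n) + INR (S n) * E t); split; [|split].
    + intros t; evar_last.
      * apply (is_derive_plus (V := R_NormedModule)).
        -- auto_derive; [easy | reflexivity].
        -- apply is_derive_scal, HE.
      * change (match n with 0%nat => 1 | S _ => INR n + 1 end) with (INR (S n)).
        unfold plus; simpl; ring.
    + rewrite E0; simpl; ring.
    + replace (INR (fact (S n))) with (-1 * 0 + INR (S n) * INR (fact n))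
        by (rewrite fact_simpl, mult_INR; ring).
      apply filterlim_Rplus; apply filterlim_Rscal; [apply filterlim_pow_mul_exp | exact EL].
Qed.

(** Integration by parts from n to n+1 contributes the integral n! of e^-t t^n, and (n+1)! H_n + n!
    = (n+1)! H_(n+1). *)
Lemma exp_pow_ln_antiderivative (n : nat) : exists E : R -> R,
  (forall t, 0 < t -> is_derive E t (exp (- t) * ln t * t ^ n)) /\
  filterlim E (at_right 0) (locally 0) /\
  filterlim E (Rbar_locally p_infty) (locally (INR (fact n) * (harmonic n - euler_gamma))).
Proof.
  induction n as [|n [E [HE [E0 EL]]]].
  (* In the derivative, (1 - e^-t)/t cancels that of [ein]. The summand 1 in 1 - e^-t makes the
     function vanish at 0; at infinity it leaves ln t - ein t, which tends to minus Euler's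
     constant. *)
  - exists (fun t => (1 - exp (- t)) * ln t + -1 * ein t); split; [|split].
    + intros t Ht; evar_last.
      * apply (is_derive_plus (V := R_NormedModule)).
        -- auto_derive; [easy | reflexivity].
        -- apply is_derive_scal, is_derive_ein.
      * rewrite betaT_0_0_neg by lra; unfold plus; simpl; field; lra.
    + replace 0 with (0 + -1 * 0) at 2 by ring; apply filterlim_Rplus.
      * apply filterlim_Rabs_le_0 with (fun t => -1 * (t * ln t)).
        -- apply filter_imp with (2 := at_right_0_lt1); intros t Ht.
           assert (ln t <= 0) by (rewrite <- ln_1; apply ln_le; lra).
           pose proof (exp_ineq1_le (- t)).
           assert (exp (- t) <= 1) by (rewrite <- exp_0; apply exp_le; lra).
           rewrite Rabs_mult, Rabs_pos_eq, Rabs_left1 by lra; nra.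
        -- replace 0 with (-1 * 0) at 2 by ring; apply filterlim_Rscal, filterlim_mul_ln_0.
      * apply filterlim_Rscal; rewrite <- ein_0 at 2.
        eapply is_derive_filterlim_at_right, is_derive_ein.
    + apply (filterlim_ext (fun t => -1 * (ein t - ln t) + -1 * (exp (- t) * t ^ 0 * ln t))).
      { intros t; simpl; ring. }
      replace (_ * _) with (-1 * euler_gamma + -1 * 0) by (rewrite harmonic_0; simpl; ring).
      apply filterlim_Rplus; apply filterlim_Rscal;
        [apply filterlim_ein_sub_ln | apply filterlim_pow_mul_exp_ln].
  - destruct (exp_pow_antiderivative n) as [P [HP [P0 PL]]].
    exists (fun t => (-1 * (exp (- t) * t ^ S n * ln t) + INR (S n) * E t) + P t); split; [|split].
    + intros t Ht; evar_last.
      * apply (is_derive_plus (V := R_NormedModule)); [|apply HP].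
        apply (is_derive_plus (V := R_NormedModule)).
        -- auto_derive; [easy | reflexivity].
        -- now apply is_derive_scal, HE.
      * change (match n with 0%nat => 1 | S _ => INR n + 1 end) with (INR (S n)).
        unfold plus; simpl; field; lra.
    + replace 0 with (-1 * 0 + INR (S n) * 0 + 0) at 2 by ring.
      apply filterlim_Rplus; [apply filterlim_Rplus; apply filterlim_Rscal; [|exact E0]|].
      * apply filterlim_Rabs_le_0 with (fun t => -1 * (t * ln t)).
        -- apply filter_imp with (2 := at_right_0_lt1); intros t Ht.
           assert (ln t <= 0) by (rewrite <- ln_1; apply ln_le; lra).
           assert (exp (- t) <= 1) by (rewrite <- exp_0; apply exp_le; lra).
           pose proof (exp_pos (- t)).
           assert (0 <= t ^ n <= 1).
           { split; [apply pow_le; lra|]; rewrite <- (pow1 n); apply pow_incr; lra. }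
           assert (0 <= exp (- t) * (t * t ^ n)).
           { apply Rmult_le_pos; [lra|]; apply Rmult_le_pos; lra. }
           simpl pow; rewrite Rabs_mult, Rabs_pos_eq, Rabs_left1 by easy.
           assert (exp (- t) * t ^ n <= 1) by nra.
           assert (0 <= t * - ln t) by nra.
           replace (exp (- t) * (t * t ^ n) * - ln t) with (exp (- t) * t ^ n * (t * - ln t)) by ring.
           nra.
        -- replace 0 with (-1 * 0) at 2 by ring; apply filterlim_Rscal, filterlim_mul_ln_0.
      * rewrite <- P0 at 2; eapply is_derive_filterlim_at_right, HP.
    + replace (_ * (_ - _)) with (-1 * 0 + INR (S n) * (INR (fact n) * (harmonic n - euler_gamma)) + INR (fact n)).
      * repeat apply filterlim_Rplus; [apply filterlim_Rscal | apply filterlim_Rscal | ];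
          [apply filterlim_pow_mul_exp_ln | exact EL | exact PL].
      * rewrite harmonic_S, fact_simpl, mult_INR; field; now apply not_0_INR.
Qed.

(** * Termwise integration *)

Lemma filter_prod_0_infty :
  filter_prod (at_right 0) (Rbar_locally p_infty)
    (fun ab => 0 < fst ab < 1 /\ 1 < snd ab).
Proof.
  apply (Filter_prod _ _ _ (fun a => 0 < a < 1) (fun b => 1 < b)).
  - apply at_right_0_lt1.
  - now exists 1.
  - now intros.
Qed.

Lemma is_RInt_gen_antiderivative (E f : R -> R) (l : R) :
  (forall t, 0 < t -> is_derive E t (f t)) -> (forall t, 0 < t -> continuous f t) ->
  filterlim E (at_right 0) (locally 0) -> filterlim E (Rbar_locally p_infty) (locally l) ->
  is_RInt_gen f (at_right 0) (Rbar_locally p_infty) l.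
Proof.
  intros HE Hf H0 Hl.
  assert (HD : forall t, 0 < t -> Derive E t = f t) by (intros; now apply is_derive_unique, HE).
  apply (is_RInt_gen_ext (Derive E)).
  - apply filter_imp with (2 := filter_prod_0_infty); intros [a b] [Ha Hb] t; simpl in *.
    rewrite Rmin_left, Rmax_right by lra; intros Ht; apply HD; lra.
  - replace l with (l - 0) by ring; apply is_RInt_gen_Derive; try easy.
    + apply filter_imp with (2 := filter_prod_0_infty); intros [a b] [Ha Hb] t; simpl in *.
      rewrite Rmin_left, Rmax_right by lra; intros Ht; exists (f t); apply HE; lra.
    + apply filter_imp with (2 := filter_prod_0_infty); intros [a b] [Ha Hb] t; simpl in *.
      rewrite Rmin_left, Rmax_right by lra; intros Ht.
      apply (continuous_ext_loc _ f); [|apply Hf; lra].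
      assert (0 < t) by lra.
      exists (mkposreal t H); intros y Hy; symmetry; apply HD.
      apply Rabs_def2 in Hy; unfold minus, plus, opp in Hy; simpl in Hy; lra.
Qed.

Lemma continuous_exp_ln_pow (n : nat) (t : R) : 0 < t ->
  continuous (fun t => exp (- t) * ln t * t ^ n) t.
Proof.
  intros Ht; apply (ex_derive_continuous (V := R_NormedModule)); now auto_derive.
Qed.

Lemma is_RInt_gen_exp_ln_pow (n : nat) :
  is_RInt_gen (fun t => exp (- t) * ln t * t ^ n) (at_right 0) (Rbar_locally p_infty)
    (INR (fact n) * (harmonic n - euler_gamma)).
Proof.
  destruct (exp_pow_ln_antiderivative n) as [E [HE [E0 EL]]].
  apply (is_RInt_gen_antiderivative E); auto using continuous_exp_ln_pow.
Qed.

Lemma is_RInt_gen_sum_n (f : nat -> R -> R) (I : nat -> R) (N : nat) :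
  (forall k, is_RInt_gen (f k) (at_right 0) (Rbar_locally p_infty) (I k)) ->
  is_RInt_gen (fun t => sum_n (fun k => f k t) N) (at_right 0) (Rbar_locally p_infty) (sum_n I N).
Proof.
  intros H; induction N.
  - rewrite sum_O; apply (is_RInt_gen_ext (f 0%nat)); [|apply H].
    apply filter_forall; intros ab t _; now rewrite sum_O.
  - rewrite sum_Sn; apply (is_RInt_gen_ext (fun t => plus (sum_n (fun k => f k t) N) (f (S N) t))).
    + apply filter_forall; intros ab t _; now rewrite sum_Sn.
    + now apply (is_RInt_gen_plus (V := R_NormedModule)).
Qed.

(** The tail beyond N only has indices at least 1, so the term at 0 needs no bound. *)
Lemma series_tail_bound (u M : nat -> R) (s L e : R) (N : nat) :
  is_series u s -> is_series M L ->
  (forall k, Rabs (u (S k)) <= M (S k) * e) ->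
  Rabs (s - sum_n u N) <= (L - sum_n M N) * e.
Proof.
  intros Hu HM Hb.
  assert (B : forall j, Rabs (sum_n u (N + j) - sum_n u N) <= (sum_n M (N + j) - sum_n M N) * e).
  { induction j.
    - rewrite Nat.add_0_r, !Rminus_diag, Rabs_R0; lra.
    - rewrite Nat.add_succ_r, !sum_Sn; change plus with Rplus.
      specialize (Hb (N + j)%nat).
      replace (sum_n u (N + j) + u (S (N + j)) - sum_n u N)
        with ((sum_n u (N + j) - sum_n u N) + u (S (N + j))) by ring.
      eapply Rle_trans; [apply Rabs_triang|]; lra. }
  apply (is_lim_seq_le _ _ (Rabs (s - sum_n u N)) ((L - sum_n M N) * e) B).
  - apply (is_lim_seq_abs _ (s - sum_n u N)), is_lim_seq_minus'; [|apply is_lim_seq_const].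
    apply (is_lim_seq_ext (fun j => sum_n u (j + N))); [intros; now rewrite Nat.add_comm|].
    now apply is_lim_seq_incr_n.
  - apply is_lim_seq_mult'; [|apply is_lim_seq_const].
    apply is_lim_seq_minus'; [|apply is_lim_seq_const].
    apply (is_lim_seq_ext (fun j => sum_n M (j + N))); [intros; now rewrite Nat.add_comm|].
    now apply is_lim_seq_incr_n.
Qed.

(* The term [f 0] is exempt from the domination: it may be singular at [0]. *)
Lemma is_RInt_gen_series (f : nat -> R -> R) (F : R -> R) (M I : nat -> R) (L s : R) :
  (forall t, 0 < t -> continuous F t) ->
  (forall t, 0 < t -> is_series (fun k => f k t) (F t)) ->
  (forall k t, 0 < t -> Rabs (f (S k) t) <= M (S k) * exp (- t / 2)) ->
  is_series M L ->
  (forall k, is_RInt_gen (f k) (at_right 0) (Rbar_locally p_infty) (I k)) ->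
  is_series I s ->
  is_RInt_gen F (at_right 0) (Rbar_locally p_infty) s.
Proof.
  intros HF Hsum Hdom HL Hint Hs.
  apply filterlimi_locally; intros eps.
  (* The tail of M is below eps/6 and e^(-t/2) has total mass 2, so truncation costs eps/3 whatever
     the endpoints; the integral of the partial sum and the partial sum of [I] cost eps/6 each. *)
  assert (He : 0 < eps / 6) by (pose proof (cond_pos eps); lra).
  destruct (proj1 (filterlim_locally _ _) HL (mkposreal _ He)) as [N1 HN1].
  destruct (proj1 (filterlim_locally _ _) Hs (mkposreal _ He)) as [N2 HN2].
  set (N := max N1 N2).
  specialize (HN1 N ltac:(lia)); specialize (HN2 N ltac:(lia)).
  pose proof (proj1 (filterlimi_locally _ _) (is_RInt_gen_sum_n f I N Hint) (mkposreal _ He)) as HN.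
  apply filter_imp with (2 := filter_and _ _ filter_prod_0_infty HN).
  intros [a b] [[Ha Hb] [y [Hy By]]]; simpl fst in *; simpl snd in *.
  destruct (ex_RInt_continuous (V := R_CompleteNormedModule) F a b) as [z Hz].
  { intros t; rewrite Rmin_left, Rmax_right by lra; intros Ht; apply HF; lra. }
  exists z; split; [exact Hz|].
  assert (Hdiff : norm (minus z y) <= (L - sum_n M N) * (-2 * exp (- b / 2) - -2 * exp (- a / 2))).
  { apply (norm_RInt_le (fun t => minus (F t) (sum_n (fun k => f k t) N))
      (fun t => (L - sum_n M N) * exp (- t / 2)) a b); [lra| | |].
    - intros t Ht; apply (series_tail_bound (fun k => f k t)); [apply Hsum; lra | exact HL |].
      intros k; apply Hdom; lra.
    - now apply (is_RInt_minus (V := R_NormedModule)).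
    - apply (is_RInt_scal (V := R_NormedModule)).
      apply (is_RInt_derive (V := R_CompleteNormedModule) (fun t => -2 * exp (- t / 2))).
      + intros t _; auto_derive; [easy|]; unfold Rdiv; eq_over R; field.
      + intros t _; apply (ex_derive_continuous (V := R_NormedModule)); now auto_derive. }
  assert (B1 : Rabs (L - sum_n M N) < eps / 6) by (rewrite Rabs_minus_sym; exact HN1).
  assert (B2 : Rabs (sum_n I N - s) < eps / 6) by exact HN2.
  assert (B3 : Rabs (y - sum_n I N) < eps / 6) by exact By.
  change (Rabs (z - y) <= (L - sum_n M N) * (-2 * exp (- b / 2) - -2 * exp (- a / 2))) in Hdiff.
  change (Rabs (z - s) < eps).
  apply Rabs_def2 in B1; apply Rabs_def2 in B2; apply Rabs_def2 in B3.
  assert (0 < exp (- b / 2)) by apply exp_pos.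
  assert (exp (- a / 2) <= 1) by (rewrite <- exp_0; apply exp_le; lra).
  assert (exp (- b / 2) <= exp (- a / 2)) by (apply exp_le; lra).
  assert (Rabs (z - y) <= eps / 3).
  { eapply Rle_trans; [exact Hdiff|].
    apply Rle_trans with (eps / 6 * (-2 * exp (- b / 2) - -2 * exp (- a / 2))).
    - apply Rmult_le_compat_r; lra.
    - replace (eps / 3) with (eps / 6 * 2) by field; apply Rmult_le_compat_l; lra. }
  apply Rabs_le_between in H2.
  apply Rabs_def1; lra.
Qed.

Lemma pow_le_exp_half (n : nat) (t : R) : 0 <= t ->
  t ^ n <= 2 ^ n * INR (fact n) * exp (t / 2).
Proof.
  intros Ht; pose proof (pow_div_fact_le_exp n (t / 2) ltac:(lra)) as H.
  apply Rle_div_l in H; [|apply INR_fact_lt_0].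
  replace (t ^ n) with (2 ^ n * (t / 2) ^ n) by (rewrite <- Rpow_mult_distr; f_equal; field).
  rewrite Rmult_assoc; apply Rmult_le_compat_l; [apply pow_le; lra | lra].
Qed.

Lemma mul_Rabs_ln_le (t : R) : 0 < t -> t * Rabs (ln t) <= 1 + t * t.
Proof.
  intros Ht; destruct (Rle_dec 1 t) as [H1|H1].
  - rewrite Rabs_pos_eq by (rewrite <- ln_1; apply ln_le; lra).
    pose proof (ln_le_sub1 t Ht); nra.
  - rewrite Rabs_left1 by (rewrite <- ln_1; apply ln_le; lra).
    pose proof (ln_le_sub1 (/ t) (Rinv_0_lt_compat _ Ht)) as L; rewrite ln_Rinv in L by easy.
    assert (t * / t = 1) by (apply Rinv_r; lra); nra.
Qed.

(** One factor t tames the logarithm at 0 through t |ln t| <= 1 + t^2, hence the exponent j+1. A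
    factor e^(t/2) absorbs t^j and t^(j+2), each costing at most 2^(j+2) (j+2)!. *)
Lemma exp_ln_pow_bound (j : nat) (t : R) : 0 < t ->
  Rabs (exp (- t) * ln t * t ^ S j)
  <= 2 ^ (j + 3) * INR (fact (S (S j))) * exp (- t / 2).
Proof.
  intros Ht.
  assert (0 <= t ^ j) by (apply pow_le; lra).
  pose proof (exp_pos (- t)).
  rewrite !Rabs_mult, (Rabs_pos_eq (exp _)), (Rabs_pos_eq (t ^ _)) by (lra || (apply pow_le; lra)).
  replace (exp (- t) * Rabs (ln t) * t ^ S j) with (exp (- t) * (t ^ j * (t * Rabs (ln t))))
    by (simpl; ring).
  replace (exp (- t / 2)) with (exp (- t) * exp (t / 2)) by (rewrite <- exp_plus; f_equal; field).
  replace (2 ^ (j + 3) * INR (fact (S (S j))) * (exp (- t) * exp (t / 2)))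
    with (exp (- t) * (2 ^ (j + 3) * INR (fact (S (S j))) * exp (t / 2))) by ring.
  apply Rmult_le_compat_l; [lra|].
  apply Rle_trans with (t ^ j + t ^ S (S j)).
  { pose proof (mul_Rabs_ln_le t Ht); simpl; nra. }
  pose proof (pow_le_exp_half j t ltac:(lra)) as H1.
  pose proof (pow_le_exp_half (S (S j)) t ltac:(lra)) as H2.
  assert (2 ^ j * INR (fact j) * exp (t / 2) <= 2 ^ S (S j) * INR (fact (S (S j))) * exp (t / 2)).
  { apply Rmult_le_compat_r; [left; apply exp_pos|].
    apply Rmult_le_compat.
    - apply pow_le; lra.
    - left; apply INR_fact_lt_0.
    - apply Rle_pow; [lra | lia].
    - apply le_INR, fact_le; lia. }
  replace (2 ^ (j + 3)) with (2 * 2 ^ S (S j)) by (rewrite pow_add; simpl; ring).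
  lra.
Qed.

(* [t^(-nu/2) I_nu(2 sqrt t)] for [t > 0]; entire in [t]. *)
Definition bessel_entire (nu : nat) (t : R) : R :=
  egf (fun k => / INR (fact (nu + k))) t.

Lemma inv_fact_bound (n : nat) : 0 <= / INR (fact n) <= 1.
Proof.
  assert (1 <= INR (fact n)).
  { change 1 with (INR 1); apply le_INR; pose proof (lt_O_fact n); lia. }
  split; [left; apply Rinv_0_lt_compat; lra|].
  rewrite <- Rinv_1; apply Rinv_le_contravar; lra.
Qed.

(** The Gamma factor (p+k)! over the Bessel denominator (p+m+1+k)! is beta(p+k, m) / m!. *)
Lemma is_RInt_gen_bessel_entire (p m : nat) (x : R) :
  is_RInt_gen (fun t => exp (- t) * ln t * t ^ p * bessel_entire (S (p + m)) (x * t))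
    (at_right 0) (Rbar_locally p_infty)
    (/ INR (fact m) * egf (fun k => beta (p + k) m * (harmonic (p + k) - euler_gamma)) x).
Proof.
  assert (Hgeom : geom_bounded (fun k => / INR (fact (S (p + m) + k)))).
  { apply geom_bounded_le1; intros; apply inv_fact_bound. }
  set (c := fun k => x ^ k / INR (fact k) * / INR (fact (S (p + m) + k))).
  (* The majorant comes from [exp_ln_pow_bound]: its factorial is at most that in the Bessel
     denominator, leaving 2^(p+k+2) |x|^k / k! at index k >= 1, with sum 2^(p+2) e^(2|x|) over all
     k. *)
  apply (is_RInt_gen_series
    (fun k t => c k * (exp (- t) * ln t * t ^ (p + k)))
    _
    (fun k => 2 ^ (p + 2) * (1 / INR (fact k) * (2 * Rabs x) ^ k))
    (fun k => c k * (INR (fact (p + k)) * (harmonic (p + k) - euler_gamma)))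
    (2 ^ (p + 2) * egf (fun _ => 1) (2 * Rabs x))).
  - intros t Ht; apply (continuous_mult (K := R_AbsRing)); [now apply continuous_exp_ln_pow|].
    apply (continuous_comp (Rmult x)).
    + apply (continuous_scal_r (V := R_NormedModule)), continuous_id.
    + apply (ex_derive_continuous (V := R_NormedModule)); eexists; now apply is_derive_egf.
  - intros t Ht.
    apply (is_series_ext (fun k => scal (exp (- t) * ln t * t ^ p)
      (/ INR (fact (S (p + m) + k)) / INR (fact k) * (x * t) ^ k))).
    + intros k; unfold c, scal; simpl; unfold mult; cbn -[fact plus pow].
      rewrite Rpow_mult_distr, pow_add; unfold Rdiv; ring.
    + now apply (is_series_scal (V := R_NormedModule)), is_series_egf.
  - intros k t Ht.
    replace (p + S k)%nat with (S (p + k)) by lia.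
    rewrite Rabs_mult.
    assert (0 < INR (fact (S k))) by apply INR_fact_lt_0.
    assert (Hc : Rabs (c (S k)) * INR (fact (S (S (p + k)))) <= Rabs x ^ S k / INR (fact (S k))).
    { unfold c, Rdiv; rewrite !Rabs_mult, RPow_abs.
      rewrite (Rabs_pos_eq (/ INR (fact (S k)))) by apply inv_fact_bound.
      rewrite (Rabs_pos_eq (/ INR (fact (_ + _)))) by apply inv_fact_bound.
      rewrite Rmult_assoc; rewrite <- (Rmult_1_r (_ * / INR (fact (S k)))) at 2.
      apply Rmult_le_compat_l.
      - apply Rmult_le_pos; [apply Rabs_pos | apply inv_fact_bound].
      - rewrite Rmult_comm; apply Rle_div_l; [apply INR_fact_lt_0|].
        rewrite Rmult_1_l; apply le_INR, fact_le; lia. }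
    eapply Rle_trans.
    { apply Rmult_le_compat_l; [apply Rabs_pos | now apply exp_ln_pow_bound]. }
    rewrite <- Rmult_assoc; apply Rmult_le_compat_r; [left; apply exp_pos|].
    replace (Rabs (c (S k)) * (2 ^ (p + k + 3) * INR (fact (S (S (p + k))))))
      with (2 ^ (p + k + 3) * (Rabs (c (S k)) * INR (fact (S (S (p + k)))))) by ring.
    replace (2 ^ (p + 2) * (1 / INR (fact (S k)) * (2 * Rabs x) ^ S k))
      with (2 ^ (p + k + 3) * (Rabs x ^ S k / INR (fact (S k)))).
    + apply Rmult_le_compat_l; [apply pow_le; lra | exact Hc].
    + replace (p + k + 3)%nat with (p + 2 + S k)%nat by lia.
      rewrite (pow_add 2 (p + 2) (S k)), Rpow_mult_distr; unfold Rdiv; ring.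
  - apply (is_series_scal (V := R_NormedModule)), (is_series_egf (fun _ => 1)), geom_bounded_const.
  - intros k; apply (is_RInt_gen_scal (V := R_NormedModule)), is_RInt_gen_exp_ln_pow.
  - apply (is_series_ext (fun k => scal (/ INR (fact m))
      (beta (p + k) m * (harmonic (p + k) - euler_gamma) / INR (fact k) * x ^ k))).
    + intros k; unfold c, beta; change scal with Rmult; cbv beta.
      replace (S (p + m) + k)%nat with (S (p + k + m)) by lia.
      eq_over R; field; repeat split; apply INR_fact_neq_0.
    + apply (is_series_scal (V := R_NormedModule)), is_series_egf, geom_bounded_betaU.
Qed.

(** * Real arguments of the complex functions *)

Local Open Scope C_scope.

Lemma Cexp_RtoC (u : R) : Cexp (RtoC u) = RtoC (exp u).
Proof. unfold Cexp, RtoC; simpl; rewrite cos_0, sin_0; f_equal; ring. Qed.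

Lemma Cexp_plus (z w : C) : Cexp (z + w) = Cexp z * Cexp w.
Proof.
  unfold Cexp, Cmult; simpl; rewrite exp_plus, cos_plus, sin_plus.
  f_equal; unfold Re, Im; ring.
Qed.

Lemma Cexp_0 : Cexp 0 = 1.
Proof. now rewrite Cexp_RtoC, exp_0. Qed.

Lemma Cexp_nat_mult (n : nat) (z : C) : Cexp (RtoC (INR n) * z) = Cexp z ^ n.
Proof.
  induction n as [|n IH].
  - simpl INR; now rewrite Cmult_0_l, Cexp_0.
  - rewrite S_INR, RtoC_plus, Cmult_plus_distr_r, Cexp_plus, IH, Cmult_1_l.
    simpl; ring.
Qed.

Lemma Csqrt_eq_Cexp (z : C) : z <> 0 -> Csqrt z = Cexp (RtoC (/ 2) * Clog z).
Proof.
  intros Hz; apply Cmod_gt_0 in Hz.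
  replace (RtoC (/ 2) * Clog z) with (RtoC (/ 2 * ln (Cmod z)) + (0%R, (Carg z / 2)%R)).
  - rewrite Cexp_plus, Cexp_RtoC; unfold Csqrt; f_equal; f_equal.
    rewrite <- Rpower_sqrt by easy; reflexivity.
  - unfold Clog, RtoC, Cmult, Cplus; simpl; f_equal; field.
Qed.

Lemma Cpower_half_nat (n : nat) (z : C) : z <> 0 -> Cpower z (INR n / 2) = Csqrt z ^ n.
Proof.
  intros Hz; rewrite Csqrt_eq_Cexp, <- Cexp_nat_mult by easy.
  unfold Cpower; f_equal; unfold Rdiv; rewrite RtoC_mult; ring.
Qed.

Lemma Cpower_opp (z : C) (a : R) : Cpower z (- a) * Cpower z a = 1.
Proof.
  unfold Cpower; rewrite <- Cexp_plus, RtoC_opp.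
  replace (- RtoC a * Clog z + RtoC a * Clog z) with (RtoC 0) by ring.
  apply Cexp_0.
Qed.

Lemma Carg_RtoC (x : R) : Carg (RtoC x) = acos (x / Rabs x).
Proof.
  unfold Carg; rewrite Cmod_R; simpl; destruct (Rle_dec 0 0); [reflexivity | lra].
Qed.

(** A positive factor does not change the argument, so the principal branch splits for either sign
    of x. *)
Lemma Csqrt_RtoC_scal (x t : R) : (0 < t)%R ->
  Csqrt (RtoC (x * t)) = RtoC (sqrt t) * Csqrt (RtoC x).
Proof.
  intros Ht; unfold Csqrt; rewrite !Carg_RtoC, !Cmod_R, Rabs_mult, (Rabs_pos_eq t) by lra.
  rewrite sqrt_mult_alt by apply Rabs_pos.
  replace (x * t / (Rabs x * t))%R with (x / Rabs x)%R.
  - rewrite RtoC_mult; ring.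
  - destruct (Req_dec x 0) as [->|Hx]; [unfold Rdiv; now rewrite !Rmult_0_l|].
    field; split; [lra | now apply Rabs_no_R0].
Qed.

Lemma Csqrt_sqr_RtoC (x : R) : Csqrt (RtoC x) ^ 2 = RtoC x.
Proof.
  simpl; rewrite Cmult_1_r; unfold Csqrt; rewrite Carg_RtoC, Cmod_R.
  replace (_ * _ * (_ * _)) with (RtoC (sqrt (Rabs x) * sqrt (Rabs x))
    * Cexp ((0, acos (x / Rabs x) / 2)%R + (0, acos (x / Rabs x) / 2)%R))
    by (rewrite Cexp_plus, RtoC_mult; ring).
  rewrite sqrt_sqrt by apply Rabs_pos.
  replace ((0, acos (x / Rabs x) / 2)%R + (0, acos (x / Rabs x) / 2)%R)
    with ((0, acos (x / Rabs x))%R : C) by (unfold Cplus; simpl; f_equal; field).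
  unfold Cexp, RtoC, Cmult; simpl; rewrite exp_0.
  destruct (Rtotal_order x 0) as [H|[->|H]].
  - rewrite Rabs_left by easy; replace (x / - x)%R with (- (1))%R by (field; lra).
    rewrite acos_opp, acos_1, Rminus_0_r, cos_PI, sin_PI; f_equal; ring.
  - rewrite Rabs_R0; f_equal; ring.
  - rewrite Rabs_pos_eq by lra; replace (x / x)%R with 1%R by (field; lra).
    rewrite acos_1, cos_0, sin_0; f_equal; ring.
Qed.

Lemma CSeries_RtoC_scal (a : nat -> R) (c : C) :
  CSeries (fun k => RtoC (a k) * c) = RtoC (Series a) * c.
Proof.
  unfold CSeries, RtoC, Cmult; simpl.
  f_equal.
  - rewrite (Series_ext _ (fun k => (a k * Re c)%R)) by (intros; unfold Re; simpl; ring).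
    rewrite Series_scal_r; unfold Re; ring.
  - rewrite (Series_ext _ (fun k => (a k * Im c)%R)) by (intros; unfold Im; simpl; ring).
    rewrite Series_scal_r; unfold Im; ring.
Qed.

Lemma CSeries_ext (a b : nat -> C) : (forall k, a k = b k) -> CSeries a = CSeries b.
Proof. intros E; unfold CSeries; f_equal; apply Series_ext; intros; now rewrite E. Qed.

(** Even powers of the square root are real, so all terms of a Bessel series share the single
    complex factor sqrt(w)^nu. *)
Lemma Csqrt_pow_bessel (nu k : nat) (w : R) :
  (2 * Csqrt (RtoC w) / 2) ^ (2 * k + nu) = RtoC (w ^ k) * Csqrt (RtoC w) ^ nu.
Proof.
  replace (2 * Csqrt (RtoC w) / 2) with (Csqrt (RtoC w)) by (field; intros E; apply RtoC_inj in E; lra).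
  now rewrite Cpow_add_r, Cpow_mult_r, Csqrt_sqr_RtoC, <- RtoC_pow.
Qed.

Lemma BesselI_Csqrt (nu : nat) (w : R) :
  BesselI nu (2 * Csqrt (RtoC w)) = RtoC (bessel_entire nu w) * Csqrt (RtoC w) ^ nu.
Proof.
  unfold BesselI, bessel_entire, egf, PSeries; rewrite <- CSeries_RtoC_scal.
  apply CSeries_ext; intros k; rewrite Csqrt_pow_bessel, Cmult_assoc, <- RtoC_mult.
  do 2 f_equal; field; split; apply INR_fact_neq_0.
Qed.

Lemma BesselJ_Csqrt (nu : nat) (w : R) :
  BesselJ nu (2 * Csqrt (RtoC w)) = RtoC (bessel_entire nu (- w)) * Csqrt (RtoC w) ^ nu.
Proof.
  unfold BesselJ, bessel_entire, egf, PSeries; rewrite <- CSeries_RtoC_scal.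
  apply CSeries_ext; intros k; rewrite Csqrt_pow_bessel, Cmult_assoc, <- RtoC_mult.
  do 2 f_equal; replace (- w)%R with (-1 * w)%R by ring; rewrite Rpow_mult_distr.
  field; split; apply INR_fact_neq_0.
Qed.

Lemma sqrt_pow_div_Rpower (n k : nat) (b t : R) : (0 < t)%R ->
  (INR n / 2 = b + INR k)%R -> (sqrt t ^ n / Rpower t b = t ^ k)%R.
Proof.
  intros Ht E.
  replace (sqrt t ^ n)%R with (Rpower t b * t ^ k)%R; [field; apply Rgt_not_eq, exp_pos|].
  rewrite <- (Rpower_pow k t), <- (Rpower_pow n (sqrt t)), <- Rpower_plus, <- E
    by (easy || now apply sqrt_lt_R0).
  rewrite <- Rpower_sqrt, Rpower_mult by easy; f_equal; field.
Qed.

Lemma is_RInt_RtoC_mult (f : R -> R) (a b u v : R) (c : C) :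
  is_RInt (fun t => f t * Re c)%R a b u -> is_RInt (fun t => f t * Im c)%R a b v ->
  is_RInt (V := C_R_NormedModule) (fun t => RtoC (f t) * c) a b (u, v).
Proof.
  intros Hu Hv.
  apply (is_RInt_fct_extend_pair (U := R_NormedModule) (V := R_NormedModule)).
  - apply (is_RInt_ext (fun t => f t * Re c)%R); [|exact Hu].
    intros t _; unfold Re; simpl; ring.
  - apply (is_RInt_ext (fun t => f t * Im c)%R); [|exact Hv].
    intros t _; unfold Im; simpl; ring.
Qed.

Lemma is_RInt_gen_RtoC_mult (f : R -> R) (l : R) (c : C) :
  is_RInt_gen f (at_right 0) (Rbar_locally p_infty) l ->
  is_RInt_gen (V := C_R_NormedModule) (fun t => RtoC (f t) * c)
    (at_right 0) (Rbar_locally p_infty) (RtoC l * c).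
Proof.
  intros H.
  assert (K : forall r : R, is_RInt_gen (fun t => f t * r)%R
    (at_right 0) (Rbar_locally p_infty) (l * r)%R).
  { intros r; rewrite Rmult_comm.
    apply (is_RInt_gen_ext (fun t => scal r (f t))).
    - apply filter_forall; intros ab t _; apply Rmult_comm.
    - now apply (is_RInt_gen_scal (V := R_NormedModule)). }
  apply filterlimi_locally; intros eps.
  pose proof (proj1 (filterlimi_locally _ _) (K (Re c)) eps) as K1.
  pose proof (proj1 (filterlimi_locally _ _) (K (Im c)) eps) as K2.
  apply filter_imp with (2 := filter_and _ _ K1 K2); intros ab [[u [Hu Bu]] [v [Hv Bv]]].
  exists (u, v); split; [now apply is_RInt_RtoC_mult|].
  replace (RtoC l * c) with ((l * Re c)%R, (l * Im c)%R)
    by (unfold Cmult, RtoC, Re, Im; simpl; f_equal; ring).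
  split; assumption.
Qed.

(** * The bracket of [calF] and its derivatives on the real line *)

Lemma CInt0_RtoC (f : C -> C) (h : R -> R) (w l : R) : w <> 0%R ->
  (forall u, u <> 0%R -> f (RtoC u) = RtoC (h u)) ->
  is_RInt (fun s => w * h (s * w))%R 0 1 l ->
  CInt0 f (RtoC w) = RtoC l.
Proof.
  intros Hw Hf Hl; apply (is_RInt_unique (V := C_R_CompleteNormedModule)).
  apply (is_RInt_ext (V := C_R_NormedModule) (fun s => RtoC (w * h (s * w)%R) * 1)).
  - rewrite Rmin_left, Rmax_right by lra; intros s Hs.
    rewrite <- (RtoC_mult s w), Hf, RtoC_mult; [eq_over C; ring|].
    apply Rmult_integral_contrapositive; split; [lra | easy].
  - apply is_RInt_RtoC_mult; simpl.
    + apply (is_RInt_ext (fun s => w * h (s * w))%R); [intros; unfold Re; simpl; ring | exact Hl].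
    + apply (is_RInt_ext (fun s => 0)%R); [intros; unfold Im; simpl; ring|].
      evar_last; [apply (is_RInt_const (V := R_NormedModule)) | apply Rmult_0_r].
Qed.

Lemma is_RInt_unit_segment (k K : R -> R) (w : R) :
  (forall v, is_derive K v (k v)) -> (forall v, ex_derive k v) ->
  is_RInt (fun s => w * k (s * w))%R 0 1 (K w - K 0)%R.
Proof.
  intros HK Hk.
  evar_last.
  - apply (is_RInt_derive (V := R_CompleteNormedModule) (fun s => K (s * w)%R)).
    + intros s _; evar_last.
      * apply (is_derive_comp K (fun s => s * w)%R); [apply HK|].
        auto_derive; [easy | reflexivity].
      * unfold scal; simpl; unfold mult; simpl; ring.
    + intros s _; apply (ex_derive_continuous (V := R_NormedModule)).
      apply ex_derive_scal, (ex_derive_comp k (fun s => s * w)%R); [apply Hk | now auto_derive].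
  - unfold minus, plus, opp; simpl; rewrite Rmult_1_l, Rmult_0_l; reflexivity.
Qed.

Lemma ex_derive_betaT (p m : nat) (x : R) : ex_derive (betaT p m) x.
Proof.
  eexists; apply is_derive_egf, geom_bounded_le1; intros; apply beta_bound.
Qed.

Lemma betaT_0_0_div (u : R) : u <> 0%R -> betaT 0 0 u = ((exp u - 1) / u)%R.
Proof. intros Hu; rewrite <- betaT_0_0; field; easy. Qed.

(** sinh u / u is the mean of (e^u - 1)/u and (1 - e^-u)/u, that is of [betaT 0 0] at u and -u,
    which removes the singularity at 0. [Chi] uses half their difference. *)
Lemma Shi_RtoC (w : R) : w <> 0%R -> Shi (RtoC w) = RtoC ((- (w * gder 0 w) + ein w) / 2).
Proof.
  intros Hw; apply (CInt0_RtoC _ (fun u => (betaT 0 0 u + betaT 0 0 (- u)) / 2)%R); [easy| |].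
  - intros u Hu; unfold Csinh; rewrite <- RtoC_opp, !Cexp_RtoC, betaT_0_0_div, betaT_0_0_neg by easy.
    rewrite <- RtoC_minus, <- !RtoC_div by (lra || easy); f_equal; field; easy.
  - evar_last.
    + apply (is_RInt_unit_segment (fun u => (betaT 0 0 u + betaT 0 0 (- u)) / 2)%R
        (fun v => (- (v * gder 0 v) + ein v) / 2)%R).
      * intros v; apply (is_derive_ext (fun v => / 2 * (- (v * gder 0 v) + ein v))%R).
        { intros; apply Rmult_comm. }
        replace ((betaT 0 0 v + betaT 0 0 (- v)) / 2)%R
          with (/ 2 * (betaT 0 0 v + betaT 0 0 (- v)))%R by apply Rmult_comm.
        apply (is_derive_scal), (is_derive_plus (V := R_NormedModule));
          [apply is_derive_mul_gder_0 | apply is_derive_ein].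
      * intros v; apply (ex_derive_ext (fun v => / 2 * (betaT 0 0 v + betaT 0 0 (- v)))%R).
        { intros; apply Rmult_comm. }
        apply ex_derive_scal, (ex_derive_plus (V := R_NormedModule)); [apply ex_derive_betaT|].
        apply (ex_derive_comp (betaT 0 0) Ropp); [apply ex_derive_betaT | now auto_derive].
    + simpl; rewrite ein_0; field.
Qed.

Lemma Chi_RtoC (w : R) : w <> 0%R ->
  Chi (RtoC w) = RtoC euler_gamma + Clog (RtoC w) + RtoC ((- (w * gder 0 w) - ein w) / 2).
Proof.
  intros Hw; unfold Chi; f_equal.
  apply (CInt0_RtoC _ (fun u => (betaT 0 0 u - betaT 0 0 (- u)) / 2)%R); [easy| |].
  - intros u Hu; unfold Ccosh; rewrite <- RtoC_opp, !Cexp_RtoC, betaT_0_0_div, betaT_0_0_neg by easy.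
    rewrite <- RtoC_plus, <- RtoC_div, <- RtoC_minus, <- RtoC_div by (lra || easy); f_equal; field; easy.
  - evar_last.
    + apply (is_RInt_unit_segment (fun u => (betaT 0 0 u - betaT 0 0 (- u)) / 2)%R
        (fun v => (- (v * gder 0 v) - ein v) / 2)%R).
      * intros v; apply (is_derive_ext (fun v => / 2 * (- (v * gder 0 v) - ein v))%R).
        { intros; apply Rmult_comm. }
        replace ((betaT 0 0 v - betaT 0 0 (- v)) / 2)%R
          with (/ 2 * (betaT 0 0 v - betaT 0 0 (- v)))%R by apply Rmult_comm.
        apply (is_derive_scal), (is_derive_minus (V := R_NormedModule));
          [apply is_derive_mul_gder_0 | apply is_derive_ein].
      * intros v; apply (ex_derive_ext (fun v => / 2 * (betaT 0 0 v - betaT 0 0 (- v)))%R).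
        { intros; apply Rmult_comm. }
        apply ex_derive_scal, (ex_derive_minus (V := R_NormedModule)); [apply ex_derive_betaT|].
        apply (ex_derive_comp (betaT 0 0) Ropp); [apply ex_derive_betaT | now auto_derive].
    + simpl; rewrite ein_0; field.
Qed.

(** The two logarithms cancel, including the imaginary part on the negative axis, and so does
    [euler_gamma]. What remains of Chi + Shi is the integral of (e^s - 1)/s. *)
Lemma chi_bracket_RtoC (w : R) : w <> 0%R -> chi_bracket (RtoC w) = RtoC (gder 0 w).
Proof.
  intros Hw; unfold chi_bracket; rewrite Shi_RtoC, Chi_RtoC by easy.
  replace (_ + RtoC euler_gamma)
    with (- (RtoC ((- (w * gder 0 w) - ein w) / 2) + RtoC ((- (w * gder 0 w) + ein w) / 2))) by ring.
  rewrite <- RtoC_plus, <- RtoC_opp, <- RtoC_div by easy; f_equal; field; easy.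
Qed.

(* [C_lim] only looks along horizontal lines, so at real points [C_derive] is the real derivative. *)
Lemma C_derive_RtoC (f : C -> C) (h : R -> R) (w l : R) : w <> 0%R ->
  (forall y, y <> 0%R -> f (RtoC y) = RtoC (h y)) -> is_derive h w l ->
  C_derive f (RtoC w) = RtoC l.
Proof.
  intros Hw Hf Hh.
  assert (Q : Rbar_locally' w (fun y : R =>
    (f (y, 0%R) - f (RtoC w)) / ((y, 0%R) - RtoC w) = RtoC ((h y - h w) / (y - w)))).
  { assert (Hp : (0 < Rabs w)%R) by now apply Rabs_pos_lt.
    exists (mkposreal _ Hp); intros y Hy Hyw.
    assert (y <> 0%R).
    { intros ->; unfold ball in Hy; simpl in Hy; unfold AbsRing_ball, abs, minus, plus, opp in Hy;
        simpl in Hy; rewrite Rplus_0_l, Rabs_Ropp in Hy; lra. }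
    change (y, 0%R) with (RtoC y).
    rewrite !Hf, <- !RtoC_minus, <- RtoC_div by (auto; lra); reflexivity. }
  set (q := fun y : R => (f (y, 0%R) - f (RtoC w)) / ((y, 0%R) - RtoC w)) in Q.
  change ((real (Lim (fun y => fst (q y)) w), real (Lim (fun y => snd (q y)) w)) = RtoC l).
  rewrite (is_lim_unique (fun y => fst (q y)) w l), (is_lim_unique (fun y => snd (q y)) w 0%R);
    [reflexivity| |].
  - apply (is_lim_ext_loc (fun _ => 0%R)); [|apply is_lim_const].
    apply filter_imp with (2 := Q); intros y E; unfold q; now rewrite E.
  - apply (is_lim_ext_loc (fun y => (h y - h w) / (y - w))%R).
    { apply filter_imp with (2 := Q); intros y E; unfold q; now rewrite E. }
    apply is_lim_spec; intros eps.
    apply is_derive_Reals in Hh; destruct (Hh eps (cond_pos eps)) as [d Hd].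
    exists d; intros y Hy Hyw.
    specialize (Hd (y - w)%R ltac:(lra) Hy).
    now rewrite Rplus_minus in Hd.
Qed.

Lemma C_derive_n_chi_bracket (n : nat) (w : R) : w <> 0%R ->
  C_derive_n n chi_bracket (RtoC w) = RtoC (gder n w).
Proof.
  revert w; induction n as [|n IH]; intros w Hw; [now apply chi_bracket_RtoC|].
  apply (C_derive_RtoC _ (gder n)); [easy | exact IH | apply is_derive_gder].
Qed.

(** * Translation of [calP] and [calF], and assembly *)

Lemma sum_n_RtoC (f : nat -> R) (k : nat) :
  sum_n (G := C_AbelianMonoid) (fun n => RtoC (f n)) k = RtoC (sum_n f k).
Proof.
  induction k as [|k IH]; [now rewrite !sum_O|].
  rewrite !sum_Sn, IH; symmetry; apply RtoC_plus.
Qed.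

Lemma calP_RtoC (s : Z) (k q : nat) (y : R) : s = (Z.of_nat k - Z.of_nat q)%Z ->
  calP s k (RtoC y) = RtoC (polyP k q y).
Proof.
  intros ->; unfold calP, polyP, binom_sum; rewrite <- sum_n_RtoC.
  apply sum_n_ext_loc; intros n Hn.
  replace (Z.to_nat _) with (k + q - n)%nat by lia.
  now rewrite <- RtoC_pow, <- RtoC_mult, Rmult_assoc.
Qed.

Lemma calF_RtoC (s : Z) (k q : nat) (y : R) : y <> 0%R -> s = (Z.of_nat k - Z.of_nat q)%Z ->
  calF s k (RtoC y) = RtoC (altG k q y).
Proof.
  intros Hy ->; unfold calF, altG, binom_sum; rewrite <- sum_n_RtoC.
  apply sum_n_ext_loc; intros n Hn.
  replace (Z.to_nat _) with (n + q)%nat by lia.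
  rewrite C_derive_n_chi_bracket, <- RtoC_mult by easy; f_equal; ring.
Qed.

(** The scale [y] is x for I and -x for J, while the branch factor is (sqrt x)^nu in both. The
    exponent [b] makes t^(nu/2) / t^b the integer power t^p. *)
Lemma is_RInt_gen_bessel (B : C -> C) (p m : nat) (b x y : R) :
  (INR (S (p + m)) / 2 = b + INR p)%R ->
  (forall t, (0 < t)%R -> B (2 * Csqrt (RtoC (x * t)))
     = RtoC (bessel_entire (S (p + m)) (y * t)) * Csqrt (RtoC (x * t)) ^ S (p + m)) ->
  is_RInt_gen (V := C_R_NormedModule)
    (fun t => RtoC (exp (- t) * ln t / Rpower t b) * B (2 * Csqrt (RtoC (x * t))))
    (at_right 0) (Rbar_locally p_infty)
    (RtoC (/ INR (fact m) * egf (fun k => beta (p + k) m * (harmonic (p + k) - euler_gamma))%R y)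
     * Csqrt (RtoC x) ^ S (p + m)).
Proof.
  intros Eb EB.
  apply (is_RInt_gen_ext (V := C_R_NormedModule)
    (fun t => RtoC (exp (- t) * ln t * t ^ p * bessel_entire (S (p + m)) (y * t))
      * Csqrt (RtoC x) ^ S (p + m))).
  - apply filter_imp with (2 := filter_prod_0_infty); intros [c d] [Hc Hd] t; simpl fst in *; simpl snd in *.
    rewrite Rmin_left, Rmax_right by lra; intros Ht.
    rewrite EB, Csqrt_RtoC_scal, Cpow_mult_l, <- RtoC_pow by lra.
    rewrite <- (sqrt_pow_div_Rpower (S (p + m)) p b t ltac:(lra) Eb).
    unfold Rdiv; rewrite !RtoC_mult; eq_over C; ring.
  - apply is_RInt_gen_RtoC_mult, is_RInt_gen_bessel_entire.
Qed.

(** This lets both powers of x in the result share the factor (sqrt x)^nu that the integral carries,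
    leaving a real identity. *)
Lemma Cpower_neg_half_nat (n : nat) (x : R) : x <> 0%R ->
  Cpower (RtoC x) (- (INR n / 2)) = RtoC (/ x ^ n) * Csqrt (RtoC x) ^ n.
Proof.
  intros Hx; assert (Hz : RtoC x <> 0) by (intros E; now apply RtoC_inj in E).
  assert (Hp : (x ^ n)%R <> 0%R) by now apply pow_nonzero.
  pose proof (Cpower_opp (RtoC x) (INR n / 2)) as E.
  rewrite Cpower_half_nat in E by easy.
  set (c := Csqrt (RtoC x) ^ n) in *.
  assert (Ec : c * c = RtoC (x ^ n)).
  { unfold c; rewrite <- Cpow_mult_l.
    replace (Csqrt (RtoC x) * Csqrt (RtoC x)) with (Csqrt (RtoC x) ^ 2) by (simpl; ring).
    now rewrite Csqrt_sqr_RtoC, <- RtoC_pow. }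
  replace (RtoC (/ x ^ n) * c) with (RtoC (/ x ^ n) * (c * c) * Cpower (RtoC x) (- (INR n / 2))).
  - rewrite Ec, <- RtoC_mult, Rinv_l by easy; ring.
  - replace (_ * (c * c) * _) with (RtoC (/ x ^ n) * c * (Cpower (RtoC x) (- (INR n / 2)) * c)) by ring.
    rewrite E; ring.
Qed.

Theorem corollary20 (l : Z) (m : nat) (x : R)
    (hlm : (l <= Z.of_nat m)%Z) (hx : x <> 0%R) :
  let p := Z.to_nat (Z.of_nat m - l) in
  let nu := Z.to_nat (2 * Z.of_nat m + 1 - l) in
  is_RInt_gen (V := C_R_NormedModule)
    (fun t : R =>
       RtoC (exp (- t) * ln t / Rpower t ((1 + IZR l) / 2))
       * BesselI nu (2 * Csqrt (RtoC (x * t))))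
    (at_right 0) (Rbar_locally p_infty)
    (RtoC (/ INR (fact m)) *
      (RtoC ((-1) ^ p * (harmonic m - euler_gamma))
         * Cpower (RtoC x) (- INR m + (IZR l - 1) / 2)
         * (RtoC (exp x) * calP (- l) p (- RtoC x) - calP l m (RtoC x))
       - Cpower (RtoC x) (INR m + (1 - IZR l) / 2)
         * (RtoC (exp x) * calF (- l) p (- RtoC x) - calF l m (RtoC x))))
  /\
  is_RInt_gen (V := C_R_NormedModule)
    (fun t : R =>
       RtoC (exp (- t) * ln t / Rpower t ((1 - IZR l) / 2))
       * BesselJ nu (2 * Csqrt (RtoC (x * t))))
    (at_right 0) (Rbar_locally p_infty)
    (RtoC (/ INR (fact p)) *
      (RtoC ((-1) ^ p * (harmonic p - euler_gamma))
         * Cpower (RtoC x) (- INR m + (IZR l - 1) / 2)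
         * (calP (- l) p (- RtoC x) - RtoC (exp (- x)) * calP l m (RtoC x))
       + Cpower (RtoC x) (INR m + (1 - IZR l) / 2)
         * (calF (- l) p (- RtoC x) - RtoC (exp (- x)) * calF l m (RtoC x)))).
Proof.
  intros p nu.
  assert (El : l = (Z.of_nat m - Z.of_nat p)%Z) by (unfold p; lia).
  assert (Enu : nu = S (p + m)) by (unfold nu, p; lia).
  clearbody p nu.
  assert (ElR : IZR l = (INR m - INR p)%R) by (rewrite El, minus_IZR, <- !INR_IZR_INZ; ring).
  assert (EnuR : (INR (S (p + m)) = INR p + INR m + 1)%R) by (rewrite S_INR, plus_INR; ring).
  assert (Hz : RtoC x <> 0) by (intros E; now apply RtoC_inj in E).
  rewrite <- RtoC_opp.
  rewrite (calP_RtoC l m p), (calP_RtoC (- l) p m), (calF_RtoC l m p), (calF_RtoC (- l) p m)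
    by (lia || lra).
  replace (INR m + (1 - IZR l) / 2)%R with (INR (S (p + m)) / 2)%R by (rewrite EnuR, ElR; field).
  replace (- INR m + (IZR l - 1) / 2)%R with (- (INR (S (p + m)) / 2))%R by (rewrite EnuR, ElR; field).
  rewrite Cpower_half_nat, Cpower_neg_half_nat by easy.
  subst nu; split.
  - replace (_ * (_ - _)) with
      (RtoC (/ INR (fact m) * egf (fun k => beta (p + k) m * (harmonic (p + k) - euler_gamma))%R x)
       * Csqrt (RtoC x) ^ S (p + m)).
    + apply is_RInt_gen_bessel; [rewrite EnuR, ElR; field|].
      intros t Ht; apply BesselI_Csqrt.
    + rewrite log_series_closed_form by easy.
      repeat rewrite ?RtoC_mult, ?RtoC_minus; ring.
  (* For J the indices exchange roles: nu/2 - (1-l)/2 = m, so the power of t is now t^m. *)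
  - rewrite (Nat.add_comm p m).
    replace (_ * (_ + _)) with
      (RtoC (/ INR (fact p) * egf (fun k => beta (m + k) p * (harmonic (m + k) - euler_gamma))%R (- x))
       * Csqrt (RtoC x) ^ S (m + p)).
    + apply is_RInt_gen_bessel; [rewrite Nat.add_comm, EnuR, ElR; field|].
      intros t Ht; rewrite Ropp_mult_distr_l_reverse; apply BesselJ_Csqrt.
    + rewrite log_series_closed_form, Ropp_involutive by lra.
      (* The extra sign reverses the order inside the bracket of [calP] terms. *)
      replace ((-1) ^ m * (harmonic p - euler_gamma) * / (- x) ^ S (m + p))%R
        with (- ((-1) ^ p * (harmonic p - euler_gamma) * / x ^ S (m + p)))%R.
      * repeat rewrite ?RtoC_mult, ?RtoC_minus, ?RtoC_opp; ring.
      * replace (- x)%R with (-1 * x)%R by ring; rewrite Rpow_mult_distr, Rinv_mult.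
        assert (Hsq : forall k, ((-1) ^ k * (-1) ^ k = 1)%R).
        { intros k; rewrite <- Rpow_mult_distr; replace (-1 * -1)%R with 1%R by ring; apply pow1. }
        replace (/ (-1) ^ S (m + p))%R with ((-1) ^ S (m + p))%R.
        -- simpl ((-1) ^ S _)%R; rewrite pow_add.
           replace ((-1) ^ p)%R with ((-1) ^ m * (-1) ^ m * (-1) ^ p)%R at 1
             by (rewrite Hsq; ring).
           ring.
        -- rewrite <- (Rmult_1_r (/ _)), <- (Hsq (S (m + p))); field; apply pow_nonzero; lra.
Qed.
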